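(* Consider in $\mathbb{R}^n$ the differential equation $\dot x=f(x)$, where $f\colon\mathbb{R}^n\to\mathbb{R}^n$ is of class $C^1$, and let $p\in\mathbb{R}^n$ be an asymptotically stable equilibrium point. Then there are a neighborhood $U$ of $p$, a constant $a>0$ and a function $\mathcal L\colon U\to\mathbb{R}$ with the following properties: - $\mathcal L$ is differentiable on $U$ and of class $C^1$ on $U\setminus\{p\}$; - $\mathcal L(p)=0$ and $\mathcal L(x)>0$ for $x\neq p$; - $\dot{\mathcal L}=-a\mathcal L$ on $U$, where $\dot{\mathcal L}$ is the derivative along solutions of the equation. *)

(* Defs.v *)
From mathcomp Require Import ssreflect ssrfun ssrbool eqtype ssrnat seq fintype bigop.
From Stdlib Require Import Reals.
Open Scope R_scope.

Definition vec (n : nat) := 'I_n -> R.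

Definition vadd {n} (x y : vec n) : vec n := fun i => x i + y i.
Definition vsub {n} (x y : vec n) : vec n := fun i => x i - y i.

Definition vnorm {n} (x : vec n) : R :=
  sqrt (\big[Rplus/0]_(i < n) (x i * x i)).

Definition mat (m n : nat) := 'I_m -> 'I_n -> R.
Definition matvec {m n} (A : mat m n) (h : vec n) : vec m :=
  fun i => \big[Rplus/0]_(j < n) (A i j * h j).

Definition is_open {n} (U : vec n -> Prop) : Prop :=
  forall x, U x -> exists r, r > 0 /\ forall y, vnorm (vsub y x) < r -> U y.

Definition has_derivative_at {n m} (F : vec n -> vec m) (x : vec n) (A : mat m n) : Prop :=
  forall eps, eps > 0 -> exists delta, delta > 0 /\
    forall h : vec n, vnorm h < delta ->
      vnorm (vsub (vsub (F (vadd x h)) (F x)) (matvec A h)) <= eps * vnorm h.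

Definition differentiable_at {n m} (F : vec n -> vec m) (x : vec n) : Prop :=
  exists A, has_derivative_at F x A.

Definition C1_on {n m} (S : vec n -> Prop) (F : vec n -> vec m) : Prop :=
  exists DF : vec n -> mat m n,
    (forall x, S x -> has_derivative_at F x (DF x)) /\
    (forall x, S x -> forall eps, eps > 0 -> exists delta, delta > 0 /\
       forall y, S y -> vnorm (vsub y x) < delta ->
         forall i j, Rabs (DF y i j - DF x i j) < eps).

Definition as_vec1 {n} (L : vec n -> R) : vec n -> vec 1 := fun x _ => L x.

Definition solution_at {n} (f : vec n -> vec n) (phi : R -> vec n) (t : R) : Prop :=
  forall i, derivable_pt_lim (fun s => phi s i) t (f (phi t) i).

Definition forward_solution {n} (f : vec n -> vec n) (phi : R -> vec n) : Prop :=
  forall t, t >= 0 -> solution_at f phi t.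

Definition local_solution {n} (f : vec n -> vec n) (phi : R -> vec n) : Prop :=
  exists e, e > 0 /\ forall t, Rabs t < e -> solution_at f phi t.

Definition equilibrium {n} (f : vec n -> vec n) (p : vec n) : Prop :=
  forall i, f p i = 0.

Definition lyap_stable {n} (f : vec n -> vec n) (p : vec n) : Prop :=
  forall eps, eps > 0 -> exists delta, delta > 0 /\
    forall x0, vnorm (vsub x0 p) < delta ->
      (exists phi, forward_solution f phi /\ phi 0 = x0) /\
      (forall phi, forward_solution f phi -> phi 0 = x0 ->
         forall t, t >= 0 -> vnorm (vsub (phi t) p) < eps).

Definition converges_to {n} (phi : R -> vec n) (p : vec n) : Prop :=
  forall eps, eps > 0 -> exists T, forall t, t >= T -> vnorm (vsub (phi t) p) < eps.

Definition asymptotically_stable {n} (f : vec n -> vec n) (p : vec n) : Prop :=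
  equilibrium f p /\ lyap_stable f p /\
  exists eta, eta > 0 /\
    forall x0, vnorm (vsub x0 p) < eta ->
      (exists phi, forward_solution f phi /\ phi 0 = x0) /\
      (forall phi, forward_solution f phi -> phi 0 = x0 -> converges_to phi p).

Definition orbital_derivative_is {n} (f : vec n -> vec n) (L : vec n -> R)
    (x : vec n) (d : R) : Prop :=
  forall phi, local_solution f phi -> phi 0 = x ->
    derivable_pt_lim (fun t => L (phi t)) 0 d.

(* Main.v *)
Require Import Defs.
From HB Require Import structures.
From mathcomp Require Import ssreflect ssrfun ssrbool eqtype ssrnat seq fintype bigop.
From Stdlib Require Import Reals Lra FunctionalExtensionality IndefiniteDescription Classical.
From Coquelicot Require Import Coquelicot.
Open Scope R_scope.

(* Only the germ of the field at [p] matters, so it is first truncated to a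
   bounded C^1 field whose derivative is bounded and uniformly continuous; its
   flow [Phi] is complete and C^1. With a C^1 bump [g >= 0] supported in an
   annulus around [p], put
     L(x) = int_{-oo}^{+oo} e^(a s) g(Phi_s x) ds.
   Translating [s] gives L(Phi_t x) = e^(-a t) L(x). Uniform attraction on
   compact sets shows that an orbit starting at distance at least eps from [p]
   meets the annulus only for times in a fixed compact interval, so L is C^1
   off [p]; it is positive there because backward orbits must leave every small
   ball. If |Phi_s x - p|^2 <= e^(C |s|) |x - p|^2, then x close to [p] meets the
   annulus only at times s < 0 with e^(C s) = O(|x - p|^2), and the choice
   a = 2 C gives L(x) = O(|x - p|^2), whence differentiability at [p]. *)

(** The truncated flow follows the given equation forward in time near [p], because stability keeps
    solutions in the unit box where [F = f]; stability and attraction therefore pass to [Phi].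
    Backward orbits of [Phi] may leave that box and then have nothing to do with [f]. This is
    harmless: the integral only has to be smooth and to scale along [Phi], and the orbital
    derivative of [L] at [x] depends on a solution only through its velocity [f x = F x], since [L]
    is differentiable at [x]. The delicate point is [p] itself. The time window during which an
    orbit meets the annulus grows without bound as [x] tends to [p], so differentiation under the
    integral gives nothing there. The weight has to compensate: of the two factors [exp (C * s)] in
    [exp (2 * C * s)], one is bounded by a multiple of [|x - p|^2] while the orbit is in the
    annulus, and the other has an integral over negative times bounded independently of the window.
    Squared distances are used throughout because they are smooth at [p] and satisfy a linear
    differential inequality. *)

HB.instance Definition _ := Monoid.isComLaw.Build R 0 Rplus
  (fun x y z => esym (Rplus_assoc x y z)) Rplus_comm Rplus_0_l.

(** * Finite sums of reals *)

Notation "\rsum_ ( i < n ) F" := (\big[Rplus/0]_(i < n) F)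
  (at level 36, F at level 36, i, n at level 50).

Lemma rsum_ext n (F G : 'I_n -> R) : (forall i, F i = G i) ->
  \rsum_(i < n) F i = \rsum_(i < n) G i.
Proof. by move=> h; apply: eq_bigr => i _. Qed.

Lemma rsum_le n (F G : 'I_n -> R) : (forall i, F i <= G i) ->
  \rsum_(i < n) F i <= \rsum_(i < n) G i.
Proof.
move=> h; elim/big_ind2: _ => [|x1 x2 y1 y2 *|i _]; [lra|lra|exact: h].
Qed.

Lemma rsum_ge0 n (F : 'I_n -> R) : (forall i, 0 <= F i) -> 0 <= \rsum_(i < n) F i.
Proof. move=> h; elim/big_ind: _ => [|x y *|i _]; [lra|lra|exact: h]. Qed.

Lemma rsum_plus n (F G : 'I_n -> R) :
  \rsum_(i < n) (F i + G i) = \rsum_(i < n) F i + \rsum_(i < n) G i.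
Proof. exact: big_split. Qed.

Lemma rsum_scal n c (F : 'I_n -> R) :
  \rsum_(i < n) (c * F i) = c * \rsum_(i < n) F i.
Proof.
elim/big_ind2: _ => [|x1 x2 y1 y2 -> ->|//]; ring.
Qed.

Lemma rsum_minus n (F G : 'I_n -> R) :
  \rsum_(i < n) (F i - G i) = \rsum_(i < n) F i - \rsum_(i < n) G i.
Proof.
rewrite (rsum_ext _ _ (fun i => F i + -1 * G i)); last by move=> i; ring.
rewrite rsum_plus rsum_scal; ring.
Qed.

Lemma rsum_abs n (F : 'I_n -> R) :
  Rabs (\rsum_(i < n) F i) <= \rsum_(i < n) Rabs (F i).
Proof.
elim/big_ind2: _ => [|x1 x2 y1 y2 h1 h2|i _]; [rewrite Rabs_R0; lra| |lra].
by apply: Rle_trans (Rabs_triang _ _) _; lra.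
Qed.

Lemma rsum_term n (F : 'I_n -> R) i : (forall j, 0 <= F j) ->
  F i <= \rsum_(j < n) F j.
Proof.
move=> h; rewrite (bigD1 i) //=.
have h1 : 0 <= \big[Rplus/0]_(j < n | j != i) F j.
  by elim/big_ind: _ => [|x y *|j _]; [lra|lra|exact: h].
rewrite -[X in X <= _]Rplus_0_r; exact: Rplus_le_compat_l.
Qed.

Lemma rsum_const n c : \rsum_(i < n) c = INR n * c.
Proof.
elim: n => [|n IH]; first by rewrite big_ord0 /=; ring.
by rewrite big_ord_recl IH S_INR; ring.
Qed.

Lemma rsum_delta n (F : 'I_n -> R) i :
  \rsum_(j < n) (F j * (if j == i then 1 else 0)) = F i.
Proof.
rewrite (bigD1 i) //= eqxx big1 ?Rmult_1_r ?Rplus_0_r // => j /negbTE ->.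
by rewrite Rmult_0_r.
Qed.

Lemma is_derive_rsum n (F : R -> 'I_n -> R) (dF : 'I_n -> R) t :
  (forall i, is_derive (fun s => F s i) t (dF i)) ->
  is_derive (fun s => \rsum_(i < n) F s i) t (\rsum_(i < n) dF i).
Proof.
elim: n F dF => [|n IH] F dF h.
  rewrite big_ord0; apply: (is_derive_ext (fun _ => 0)); last exact: is_derive_const.
  by move=> s; rewrite big_ord0.
rewrite big_ord_recl.
apply: (is_derive_ext (fun s => F s ord0 + \rsum_(i < n) F s (lift ord0 i))).
  by move=> s; rewrite big_ord_recl.
apply: is_derive_plus; first exact: h.
by apply: (IH (fun s i => F s (lift ord0 i))).
Qed.

Lemma continuous_rsum (T : UniformSpace) n (F : T -> 'I_n -> R) t :
  (forall i, continuous (fun s => F s i) t) ->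
  continuous (fun s => \rsum_(i < n) F s i) t.
Proof.
elim: n F => [|n IH] F h.
  apply: (continuous_ext (fun _ => 0)); last exact: continuous_const.
  by move=> s; rewrite big_ord0.
apply: (continuous_ext (fun s => F s ord0 + \rsum_(i < n) F s (lift ord0 i))).
  by move=> s; rewrite big_ord_recl.
apply: (continuous_plus (V := R_NormedModule)); first exact: h.
by apply: (IH (fun s i => F s (lift ord0 i))).
Qed.

Lemma continuousP (f : R -> R) t : continuous f t <->
  (forall eps, eps > 0 -> exists delta, delta > 0 /\
    forall s, Rabs (s - t) < delta -> Rabs (f s - f t) < eps).
Proof.
split=> [h eps he|h P [e he]].
- have [d hd] := proj1 (filterlim_locally f (f t)) h (mkposreal eps he).
  by exists d; split; [exact: cond_pos|move=> s hs; apply: hd].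
- have [d [hd hs]] := h e (cond_pos e).
  by exists (mkposreal d hd) => s hs'; apply: he; apply: hs.
Qed.

(** * Norms *)

Definition norm1 {n} (x : vec n) : R := \rsum_(i < n) Rabs (x i).
Definition normsq {n} (x : vec n) : R := \rsum_(i < n) (x i * x i).

Lemma norm1_ge0 n (x : vec n) : 0 <= norm1 x.
Proof. by apply: rsum_ge0 => i; apply: Rabs_pos. Qed.

Lemma abs_le_norm1 n (x : vec n) i : Rabs (x i) <= norm1 x.
Proof. by apply: (rsum_term _ (fun i => Rabs (x i))) => j; apply: Rabs_pos. Qed.

Lemma norm1_triangle n (x y z : vec n) :
  norm1 (vsub x z) <= norm1 (vsub x y) + norm1 (vsub y z).
Proof.
rewrite /norm1 -rsum_plus; apply: rsum_le => i; rewrite /vsub.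
have -> : x i - z i = (x i - y i) + (y i - z i) by ring.
exact: Rabs_triang.
Qed.

Lemma norm1_le_const n (x : vec n) c : (forall i, Rabs (x i) <= c) ->
  norm1 x <= INR n * c.
Proof. by move=> h; rewrite -rsum_const; apply: rsum_le. Qed.

Lemma norm1_vsub0 n (x : vec n) : norm1 (vsub x x) = 0.
Proof. by apply: big1 => i _; rewrite /vsub Rminus_diag Rabs_R0. Qed.

Lemma normsq_ge0 n (x : vec n) : 0 <= normsq x.
Proof. by apply: rsum_ge0 => i; nra. Qed.

Lemma vnorm_normsq n (x : vec n) : vnorm x * vnorm x = normsq x.
Proof. exact/sqrt_sqrt/normsq_ge0. Qed.

Lemma vnorm_ge0 n (x : vec n) : 0 <= vnorm x.
Proof. exact: sqrt_pos. Qed.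

Lemma sqr_le_normsq n (x : vec n) i : x i * x i <= normsq x.
Proof. by apply: (rsum_term _ (fun i => x i * x i)) => j; nra. Qed.

Lemma abs_le_vnorm n (x : vec n) i : Rabs (x i) <= vnorm x.
Proof.
rewrite -sqrt_Rsqr_abs; apply: sqrt_le_1_alt; exact: sqr_le_normsq.
Qed.

Lemma norm1_le_vnorm n (x : vec n) : norm1 x <= (INR n + 1) * vnorm x.
Proof.
have := norm1_le_const n x (vnorm x) (abs_le_vnorm n x).
by have := vnorm_ge0 n x; nra.
Qed.

Lemma normsq_le_norm1 n (x : vec n) : normsq x <= norm1 x * norm1 x.
Proof.
rewrite {2}/norm1 -rsum_scal; apply: rsum_le => i.
have := abs_le_norm1 n x i; have := Rabs_pos (x i).
have -> : x i * x i = Rabs (x i) * Rabs (x i).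
  by rewrite -Rabs_mult Rabs_pos_eq //; nra.
nra.
Qed.

Lemma vnorm_le_norm1 n (x : vec n) : vnorm x <= norm1 x.
Proof.
rewrite -(sqrt_square (norm1 x)); last exact: norm1_ge0.
exact/sqrt_le_1_alt/normsq_le_norm1.
Qed.

(** Cauchy-Schwarz against the constant vector, obtained by summing
    [|x i| * |x j| <= (x i ^ 2 + x j ^ 2) / 2] over all pairs. *)
Lemma norm1sq_le_normsq n (x : vec n) : norm1 x * norm1 x <= INR n * normsq x.
Proof.
have h i : norm1 x * Rabs (x i) <= \rsum_(j < n) ((x i * x i + x j * x j) / 2).
  rewrite Rmult_comm -rsum_scal; apply: rsum_le => j.
  rewrite -(Rabs_pos_eq (x i * x i)) ?Rabs_mult; last by nra.
  rewrite -(Rabs_pos_eq (x j * x j)) ?Rabs_mult; last by nra.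
  by have := Rle_0_sqr (Rabs (x i) - Rabs (x j)); rewrite /Rsqr; nra.
rewrite {2}/norm1 -rsum_scal.
apply: Rle_trans (rsum_le _ _ _ h) _; right.
rewrite (rsum_ext _ _ (fun i => INR n * (/2 * (x i * x i)) + /2 * normsq x)).
  by rewrite rsum_plus !rsum_scal rsum_const /normsq; field.
move=> i; rewrite (rsum_ext _ _ (fun j => x i * x i / 2 + /2 * (x j * x j))).
  by rewrite rsum_plus rsum_scal rsum_const /normsq; field.
by move=> j; field.
Qed.

Lemma normsq_gt0 n (x p : vec n) : x <> p -> 0 < normsq (vsub x p).
Proof.
move=> hx; case: (normsq_ge0 n (vsub x p)) => // h0; case: hx.
apply: functional_extensionality => i.
by have := sqr_le_normsq n (vsub x p) i; rewrite -h0 /vsub; nra.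
Qed.

(** * Differentiation along curves *)

Lemma is_deriveP (f : R -> R) t l : is_derive f t l <->
  (forall eps, eps > 0 -> exists delta, delta > 0 /\
    forall s, Rabs (s - t) < delta ->
      Rabs (f s - f t - (s - t) * l) <= eps * Rabs (s - t)).
Proof.
rewrite is_derive_Reals; split=> h eps he.
- have [d hd] := h eps he.
  exists d; split=> [|s hs]; first exact: cond_pos.
  have [->|hn] := Req_dec s t.
    by rewrite !Rminus_diag Rmult_0_l Rminus_0_r Rabs_R0; lra.
  have hn' : s - t <> 0 by lra.
  have := hd (s - t) hn' hs; have -> : t + (s - t) = s by ring.
  have -> : f s - f t - (s - t) * l = ((f s - f t) / (s - t) - l) * (s - t) by field.
  by rewrite Rabs_mult => h'; apply: Rmult_le_compat_r; [exact: Rabs_pos|lra].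
- have he2 : eps / 2 > 0 by lra.
  have [d [hd hs]] := h _ he2.
  exists (mkposreal d hd) => u hu hud.
  have := hs (t + u); have -> : t + u - t = u by ring.
  move=> /(_ hud) h'.
  have -> : (f (t + u) - f t) / u - l = (f (t + u) - f t - u * l) / u by field.
  rewrite Rabs_div //; have hp : 0 < Rabs u by exact: Rabs_pos_lt.
  by apply: (Rmult_lt_reg_r (Rabs u)) => //; field_simplify; nra.
Qed.

Lemma finite_delta n (P : 'I_n -> R -> Prop) :
  (forall i d d', 0 < d' <= d -> P i d -> P i d') ->
  (forall i, exists d, d > 0 /\ P i d) ->
  exists d, d > 0 /\ forall i, P i d.
Proof.
elim: n P => [|n IH] P hm hP; first by exists 1; split; [lra|case].
have [i d d' hd|i|d1 [hd1 h1]] := IH (fun i => P (lift ord0 i)).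
- exact: hm.
- exact: hP.
- have [d0 [hd0 h0]] := hP ord0.
  have hmin : 0 < Rmin d0 d1 by exact: Rmin_pos.
  exists (Rmin d0 d1); split=> // i.
  case: (unliftP ord0 i) => [j ->|->].
    by apply: hm (h1 j); split=> //; apply: Rmin_r.
  by apply: hm h0; split=> //; apply: Rmin_l.
Qed.

(* Differentiability with gradient [d] tested on curves through [y]: it
   composes without estimates, and with a continuous gradient it is
   equivalent to Frechet differentiability. *)
Definition curve_diff_at {n} (F : vec n -> R) (y d : vec n) : Prop :=
  forall (c : R -> vec n) (v : vec n) t, c t = y ->
    (forall j, is_derive (fun s => c s j) t (v j)) ->
    is_derive (fun s => F (c s)) t (\rsum_(j < n) (d j * v j)).

Lemma rsum_mul_le n (d h : vec n) e : (forall j, Rabs (d j) <= e) ->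
  Rabs (\rsum_(j < n) (d j * h j)) <= e * norm1 h.
Proof.
move=> hd; apply: Rle_trans (rsum_abs _ _) _; rewrite -rsum_scal.
apply: rsum_le => j; rewrite Rabs_mult.
by apply: Rmult_le_compat_r => //; apply: Rabs_pos.
Qed.

Lemma rsum_mul_le' n (d h : vec n) e : (forall j, Rabs (h j) <= e) ->
  Rabs (\rsum_(j < n) (d j * h j)) <= e * norm1 d.
Proof.
move=> hd; rewrite (rsum_ext _ _ (fun j => h j * d j)); last by move=> j; ring.
exact: rsum_mul_le.
Qed.

Lemma curve_diff_of_little_o n (F : vec n -> R) y d :
  (forall eps, eps > 0 -> exists delta, delta > 0 /\ forall z, norm1 (vsub z y) < delta ->
    Rabs (F z - F y - \rsum_(j < n) (d j * vsub z y j)) <= eps * norm1 (vsub z y)) ->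
  curve_diff_at F y d.
Proof.
move=> hF c v t hc hv; apply/is_deriveP => eps heps.
pose V := norm1 v; pose A := norm1 d.
have hV : 0 <= V := norm1_ge0 _ v; have hA : 0 <= A := norm1_ge0 _ d.
have hn := pos_INR n.
(* The error has two halves. The remainder of [F] costs [e2] times the increment of the curve,
   itself at most [(V + INR n) * |s - t|]; the remainder of the curve costs [e1 * A]. The cap
   [e1 <= 1] is what gives the increment bound [V + INR n]. *)
pose e2 := eps / (2 * (V + INR n + 1)).
have he2 : e2 > 0 by apply: Rdiv_lt_0_compat; lra.
pose e1 := Rmin 1 (eps / (2 * (A + 1))).
have he1 : 0 < e1 by apply: Rmin_pos; [lra|apply: Rdiv_lt_0_compat; lra].
have he11 : e1 <= 1 by apply: Rmin_l.
have he1A : e1 * A <= eps / 2.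
  have h1 : e1 <= eps / (2 * (A + 1)) by apply: Rmin_r.
  have -> : eps / 2 = eps / (2 * (A + 1)) * (A + 1) by field; lra.
  by nra.
have [d2 [hd2 h2]] := hF e2 he2.
have [i r r' hr hP s hs|i|d1 [hd1 h1]] := finite_delta n (fun j r => forall s, Rabs (s - t) < r ->
   Rabs (c s j - c t j - (s - t) * v j) <= e1 * Rabs (s - t)).
- by apply: hP; lra.
- exact: (proj1 (is_deriveP _ _ _) (hv i)).
have hK s : Rabs (s - t) < d1 ->
    norm1 (vsub (c s) (c t)) <= (V + INR n) * Rabs (s - t).
  move=> hs; have -> : (V + INR n) * Rabs (s - t) =
     \rsum_(j < n) (Rabs (s - t) * Rabs (v j) + Rabs (s - t)).
    by rewrite rsum_plus rsum_scal rsum_const /V /norm1; ring.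
  apply: rsum_le => j; have := h1 j s hs.
  have := Rabs_triang (c s j - c t j - (s - t) * v j) ((s - t) * v j).
  rewrite Rabs_mult /vsub.
  have -> : c s j - c t j - (s - t) * v j + (s - t) * v j = c s j - c t j by ring.
  by have := Rabs_pos (s - t); nra.
exists (Rmin d1 (d2 / (V + INR n + 1))); split.
  by apply: Rmin_pos => //; apply: Rdiv_lt_0_compat; lra.
move=> s hs.
have hs1 : Rabs (s - t) < d1 by apply: Rlt_le_trans hs (Rmin_l _ _).
have hs2 : Rabs (s - t) * (V + INR n + 1) < d2.
  have := Rlt_le_trans _ _ _ hs (Rmin_r _ _) => h3.
  have -> : d2 = d2 / (V + INR n + 1) * (V + INR n + 1) by field; lra.
  by apply: Rmult_lt_compat_r; lra.
have hk := hK s hs1; have hp := Rabs_pos (s - t).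
have hr : norm1 (vsub (c s) y) < d2 by rewrite -hc; nra.
have {h2 hr} := h2 _ hr; rewrite -hc => h2.
have h3 : Rabs (\rsum_(j < n) (d j * (vsub (c s) (c t) j - (s - t) * v j))) <=
    e1 * Rabs (s - t) * A.
  by apply: rsum_mul_le' => j; apply: h1.
have h4 : \rsum_(j < n) (d j * (vsub (c s) (c t) j - (s - t) * v j)) =
   \rsum_(j < n) (d j * vsub (c s) (c t) j) - (s - t) * \rsum_(j < n) (d j * v j).
  by rewrite -rsum_scal -rsum_minus; apply: rsum_ext => j; ring.
rewrite {}h4 in h3.
have -> : F (c s) - F (c t) - (s - t) * \rsum_(j < n) (d j * v j) =
  (F (c s) - F (c t) - \rsum_(j < n) (d j * vsub (c s) (c t) j)) +
  (\rsum_(j < n) (d j * vsub (c s) (c t) j) - (s - t) * \rsum_(j < n) (d j * v j)).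
  by ring.
apply: Rle_trans (Rabs_triang _ _) _.
have h5 : e2 * norm1 (vsub (c s) (c t)) <= eps / 2 * Rabs (s - t).
  have -> : eps / 2 = e2 * (V + INR n + 1) by rewrite /e2; field; lra.
  rewrite Rmult_assoc; apply: Rmult_le_compat_l; lra.
nra.
Qed.

Lemma curve_diff_of_derivative n m (F : vec n -> vec m) x A i :
  has_derivative_at F x A -> curve_diff_at (fun y => F y i) x (A i).
Proof.
move=> hF; apply: curve_diff_of_little_o => eps he.
have [d [hd h]] := hF eps he; exists d; split=> // z hz.
have hz' : vadd x (vsub z x) = z.
  by apply: functional_extensionality => j; rewrite /vadd /vsub; ring.
have hv := vnorm_le_norm1 n (vsub z x).
have {h} := h (vsub z x) (Rle_lt_trans _ _ _ hv hz); rewrite hz' => h.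
have := abs_le_vnorm _ (vsub (vsub (F z) (F x)) (matvec A (vsub z x))) i.
rewrite {1 2}/vsub /matvec => h'; apply: Rle_trans h' (Rle_trans _ _ _ h _).
by apply: Rmult_le_compat_l => //; lra.
Qed.

Definition line {n} (x h : vec n) (s : R) : vec n := fun j => x j + s * h j.

Lemma norm1_line n (x h : vec n) s : norm1 (vsub (line x h s) x) = Rabs s * norm1 h.
Proof.
rewrite /norm1 -rsum_scal; apply: rsum_ext => j.
by rewrite -Rabs_mult /vsub /line; congr Rabs; ring.
Qed.

Lemma line_MVT n (F : vec n -> R) (D : vec n -> vec n) x h :
  (forall s, 0 <= s <= 1 -> curve_diff_at F (line x h s) (D (line x h s))) ->
  exists s, 0 <= s <= 1 /\
    F (vadd x h) - F x = \rsum_(j < n) (D (line x h s) j * h j).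
Proof.
move=> hD.
have hl s : 0 <= s <= 1 -> is_derive (fun s => F (line x h s)) s
    (\rsum_(j < n) (D (line x h s) j * h j)).
  move=> hs; apply: (hD s hs) => // j; rewrite /line.
  by auto_derive => //; ring.
have [s hs|s hs|s [hs hF]] := MVT_gen (fun s => F (line x h s)) 0 1
   (fun s => \rsum_(j < n) (D (line x h s) j * h j)).
- by apply: hl; rewrite Rmin_left ?Rmax_right in hs; lra.
- apply: derivable_continuous_pt.
  exists (\rsum_(j < n) (D (line x h s) j * h j)); apply/is_derive_Reals/hl.
  by rewrite Rmin_left ?Rmax_right in hs; lra.
exists s; split; first by rewrite Rmin_left ?Rmax_right in hs; lra.
rewrite Rminus_0_r Rmult_1_r in hF; rewrite -hF; congr (F _ - F _);
  by apply: functional_extensionality => j; rewrite /line /vadd; ring.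
Qed.

Lemma derivative_of_curve_diff n m (F : vec n -> vec m) (DF : vec n -> mat m n) x r :
  r > 0 ->
  (forall y, norm1 (vsub y x) < r -> forall i, curve_diff_at (fun y => F y i) y (DF y i)) ->
  (forall eps, eps > 0 -> exists delta, delta > 0 /\
    forall y, norm1 (vsub y x) < delta -> forall i j, Rabs (DF y i j - DF x i j) < eps) ->
  has_derivative_at F x (DF x).
Proof.
move=> hr hF hc eps he.
have hn := pos_INR n; have hm := pos_INR m.
(* The factor in [m] pays for summing the coordinatewise errors, the factor in [n] for replacing
   [norm1 k] by [vnorm k]. *)
pose C := (INR m + 1) * (INR n + 1).
have hC : C > 0 by rewrite /C; nra.
have he' : eps / C > 0 by apply: Rdiv_lt_0_compat.
have [d [hd h]] := hc _ he'.
pose d' := Rmin d r; have hd' : 0 < d' by apply: Rmin_pos.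
exists (d' / (INR n + 1)); split; first by apply: Rdiv_lt_0_compat; lra.
move=> k hk.
have hk1 : norm1 k < d'.
  apply: Rle_lt_trans (norm1_le_vnorm n k) _.
  have -> : d' = (INR n + 1) * (d' / (INR n + 1)) by field; lra.
  by apply: Rmult_lt_compat_l; lra.
have hk0 := norm1_ge0 n k.
have hl s : 0 <= s <= 1 -> norm1 (vsub (line x k s) x) < d'.
  by move=> hs; rewrite norm1_line Rabs_pos_eq; [nra|lra].
have hi i : Rabs (vsub (vsub (F (vadd x k)) (F x)) (matvec (DF x) k) i) <=
    eps / C * norm1 k.
  have [s hs|s [hs]] := line_MVT n (fun y => F y i) (fun y => DF y i) x k.
    by apply: hF; apply: Rlt_le_trans (hl s hs) (Rmin_r _ _).
  rewrite {1 2}/vsub /matvec => ->; rewrite -rsum_minus.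
  rewrite (rsum_ext _ _ (fun j => (DF (line x k s) i j - DF x i j) * k j)); last by move=> j; ring.
  apply: rsum_mul_le => j; apply: Rlt_le; apply: h.
  exact: Rlt_le_trans (hl s hs) (Rmin_l _ _).
apply: Rle_trans (vnorm_le_norm1 _ _) _.
apply: Rle_trans (norm1_le_const _ _ _ hi) _.
have h1 := norm1_le_vnorm n k; have h2 := vnorm_ge0 n k.
have -> : eps * vnorm k = (INR m + 1) * (eps / C * ((INR n + 1) * vnorm k)).
  by rewrite /C; field; lra.
have h3 : 0 <= eps / C * norm1 k by nra.
have h4 : eps / C * norm1 k <= eps / C * ((INR n + 1) * vnorm k) by nra.
nra.
Qed.

(** The image under [G] of a test curve is a test curve for [g], so the chain rule reduces to
    exchanging two sums. *)
Lemma curve_diff_comp n m (g : vec m -> R) (G : vec n -> vec m) x d (J : mat m n) :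
  curve_diff_at g (G x) d -> (forall i, curve_diff_at (fun y => G y i) x (J i)) ->
  curve_diff_at (fun y => g (G y)) x (fun j => \rsum_(i < m) (d i * J i j)).
Proof.
move=> hg hG c v t hc hv.
have -> : \rsum_(j < n) (\rsum_(i < m) (d i * J i j) * v j) =
          \rsum_(i < m) (d i * \rsum_(j < n) (J i j * v j)).
  rewrite (rsum_ext n _ (fun j => \rsum_(i < m) (d i * (J i j * v j)))).
    by rewrite exchange_big; apply: rsum_ext => i; rewrite rsum_scal.
  by move=> j; rewrite Rmult_comm -rsum_scal; apply: rsum_ext => i; ring.
apply: (hg (fun s => G (c s))) => [|i]; first by rewrite hc.
exact: hG.
Qed.

Lemma is_derive_sqr (f : R -> R) t l : is_derive f t l ->
  is_derive (fun s => f s * f s) t (2 * f t * l).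
Proof.
move=> h; auto_derive; first by split; [exists l|split=> //; exists l].
by rewrite (is_derive_unique (fun x => f x) _ _ h); ring.
Qed.

Lemma is_derive_reverse (f : R -> R) t l : is_derive f (- t) l ->
  is_derive (fun s => f (- s)) t (- l).
Proof.
move=> h; auto_derive; first by exists l.
by rewrite (is_derive_unique (fun x => f x) _ _ h); ring.
Qed.

(** * Gronwall estimates *)

Lemma decreasing_le (g g' : R -> R) T : 0 <= T ->
  (forall t, 0 <= t <= T -> is_derive g t (g' t) /\ g' t <= 0) -> g T <= g 0.
Proof.
move=> hT hg.
have hmm t : Rmin 0 T <= t <= Rmax 0 T -> 0 <= t <= T.
  by rewrite Rmin_left // Rmax_right.
have [t ht|t ht|t [ht h]] := MVT_gen g 0 T g'.
- by apply: (proj1 (hg t _)); apply: hmm; lra.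
- apply: derivable_continuous_pt; exists (g' t); apply/is_derive_Reals.
  exact: (proj1 (hg t (hmm t ht))).
by have [_ h'] := hg t (hmm t ht); nra.
Qed.

(** Integrating factor: [q t * exp (- C * t) - d * t] is nonincreasing, because [exp (- C * t) <= 1]
    lets [d * t] absorb the inhomogeneous term. *)
Lemma gronwall_scalar (q q' : R -> R) C d T : 0 <= C -> 0 <= d -> 0 <= T ->
  (forall t, 0 <= t <= T -> is_derive q t (q' t) /\ q' t <= C * q t + d) ->
  q T <= (q 0 + d * T) * exp (C * T).
Proof.
move=> hC hd hT hq.
pose g t := q t * exp (- C * t) - d * t.
pose g' t := (q' t - C * q t) * exp (- C * t) - d.
have hg t : 0 <= t <= T -> is_derive g t (g' t) /\ g' t <= 0.
  move=> ht; have [h1 h2] := hq t ht; rewrite /g /g'; split.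
    auto_derive; first by exists (q' t).
    by rewrite (is_derive_unique (fun x => q x) _ _ h1); ring.
  have h3 : exp (- C * t) <= 1.
    by rewrite -exp_0; case: (Req_dec (C * t) 0) => h; [right; congr exp; lra|
      left; apply: exp_increasing; nra].
  by have := exp_pos (- C * t); nra.
have := decreasing_le g g' T hT hg.
rewrite /g Rmult_0_r exp_0 Rmult_0_r Rminus_0_r Rmult_1_r => h.
have he : exp (- C * T) * exp (C * T) = 1.
  by rewrite -exp_plus -exp_0; congr exp; ring.
have hp := exp_pos (C * T).
have -> : q T = (q T * exp (- C * T)) * exp (C * T) by rewrite Rmult_assoc he; ring.
by apply: Rmult_le_compat_r; lra.
Qed.

(** The squared norm is differentiated because it is smooth at zero. The term in [B] contributes
    [2 * B * norm1 ^ 2 <= 2 * B * n * normsq], and the defect enters through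
    [2 * |u i| * e <= u i ^ 2 + e ^ 2], whence the [+ 1] in the rate. *)
Lemma gronwall_forward n (u u' : R -> vec n) B e T : 0 <= B -> 0 <= e -> 0 <= T ->
  (forall t, 0 <= t <= T -> forall i, is_derive (fun s => u s i) t (u' t i) /\
     Rabs (u' t i) <= B * norm1 (u t) + e) ->
  normsq (u T) <= (normsq (u 0) + INR n * (e * e) * T) * exp ((2 * B * INR n + 1) * T).
Proof.
move=> hB he hT hu; have hn := pos_INR n.
apply: (gronwall_scalar (fun t => normsq (u t)) (fun t => \rsum_(i < n) (2 * u t i * u' t i))) => //; [nra|nra|].
move=> t ht; split.
  apply: (is_derive_rsum _ (fun s i => u s i * u s i)) => i.
  exact: (is_derive_sqr (fun s => u s i)) (proj1 (hu t ht i)).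
apply: (Rle_trans _ (\rsum_(i < n) ((2 * B * norm1 (u t)) * Rabs (u t i) + (u t i * u t i + e * e)))).
  apply: rsum_le => i; have [_ h] := hu t ht i.
  have h1 : 2 * u t i * u' t i <= 2 * Rabs (u t i) * Rabs (u' t i).
    by have := Rle_abs (u t i * u' t i); rewrite Rabs_mult; lra.
  have -> : u t i * u t i = Rabs (u t i) * Rabs (u t i).
    by rewrite -Rabs_mult Rabs_pos_eq //; nra.
  have h2 := Rabs_pos (u t i); have h3 := Rle_0_sqr (Rabs (u t i) - e).
  rewrite /Rsqr in h3; nra.
rewrite rsum_plus rsum_scal rsum_plus rsum_const -/(norm1 (u t)) -/(normsq (u t)).
have := norm1sq_le_normsq n (u t); nra.
Qed.

Lemma gronwall n (u u' : R -> vec n) B e T : 0 <= B -> 0 <= e ->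
  (forall t, Rabs t <= T -> forall i, is_derive (fun s => u s i) t (u' t i) /\
     Rabs (u' t i) <= B * norm1 (u t) + e) ->
  forall t, Rabs t <= T ->
  normsq (u t) <= (normsq (u 0) + INR n * (e * e) * Rabs t) *
     exp ((2 * B * INR n + 1) * Rabs t).
Proof.
move=> hB he hu t; case: (Rle_dec 0 t) => ht.
  rewrite (Rabs_pos_eq t) // => htT.
  by apply: (gronwall_forward n u u') => // s hs i; apply: hu; rewrite Rabs_pos_eq; lra.
rewrite (Rabs_left t); last lra; move=> htT.
have := gronwall_forward n (fun s => u (- s)) (fun s i => - u' (- s) i) B e (- t) hB he.
rewrite Ropp_involutive Ropp_0; apply; first lra.
move=> s hs i; have [|h1 h2] := hu (- s) _ i; first by rewrite Rabs_Ropp Rabs_pos_eq; lra.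
split; last by rewrite Rabs_Ropp.
exact: (is_derive_reverse (fun s => u s i)).
Qed.

(** One constant [E] serves all curves on [[-T, T]]. The number [e] is a defect: zero when comparing
    two solutions, a coefficient error or a Taylor remainder when studying the linearised
    equation. *)
Lemma gronwall_norm1 n B T : 0 <= B -> 0 <= T -> exists E, E > 0 /\
  forall (u u' : R -> vec n) e, 0 <= e ->
  (forall t, Rabs t <= T -> forall i, is_derive (fun s => u s i) t (u' t i) /\
     Rabs (u' t i) <= B * norm1 (u t) + e) ->
  forall t, Rabs t <= T -> norm1 (u t) <= E * (norm1 (u 0) + e).
Proof.
move=> hB hT; have hn := pos_INR n.
pose X := exp ((2 * B * INR n + 1) * T); have hX : 0 < X by apply: exp_pos.
pose Y := INR n * (1 + INR n * T) * X; have hY : 0 <= Y.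
  by rewrite /Y; apply: Rmult_le_pos; [apply: Rmult_le_pos; nra|lra].
(* The squared estimate carries the factor [Y]; since [Y <= (1 + Y) ^ 2], the constant [1 + Y] works
   without a square root. *)
exists (1 + Y); split=> [|u u' e he hu t ht]; first lra.
have h1 := gronwall n u u' B e T hB he hu t ht.
have h2 : normsq (u t) <= (normsq (u 0) + INR n * (e * e) * T) * X.
  have hp := Rabs_pos t; have hq := normsq_ge0 n (u 0).
  apply: Rle_trans h1 _; apply: Rmult_le_compat.
  - by have := Rmult_le_pos _ _ hn (Rle_0_sqr e); rewrite /Rsqr; nra.
  - by left; apply: exp_pos.
  - by have := Rmult_le_pos _ _ hn (Rle_0_sqr e); rewrite /Rsqr; nra.
  rewrite /X; have : (2 * B * INR n + 1) * Rabs t <= (2 * B * INR n + 1) * T.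
    by apply: Rmult_le_compat_l; nra.
  by case=> [h|->]; [left; apply: exp_increasing|right].
have h3 := norm1sq_le_normsq n (u t); have h4 := normsq_le_norm1 n (u 0).
have h5 := norm1_ge0 n (u t); have h6 := norm1_ge0 n (u 0).
set a := norm1 (u t) in h3 h5 *; set b := norm1 (u 0) in h4 h6 *.
have h7 : a * a <= Y * ((b + e) * (b + e)).
  apply: Rle_trans h3 _.
  have -> : Y * ((b + e) * (b + e)) = INR n * ((1 + INR n * T) * ((b + e) * (b + e)) * X).
    by rewrite /Y; ring.
  apply: Rmult_le_compat_l => //; apply: Rle_trans h2 _.
  apply: Rmult_le_compat_r; first lra.
  have h8 : e * e <= (b + e) * (b + e) by nra.
  have h9 : b * b <= (b + e) * (b + e) by nra.
  have := Rmult_le_compat_l (INR n * T) _ _ ltac:(nra) h8; nra.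
apply: Rsqr_incr_0; rewrite /Rsqr //; last by nra.
apply: Rle_trans h7 _.
have -> : (1 + Y) * (b + e) * ((1 + Y) * (b + e)) = (1 + Y) * (1 + Y) * ((b + e) * (b + e)) by ring.
by apply: Rmult_le_compat_r; nra.
Qed.

(** * Picard iteration *)

Lemma continuous_comp_vec n (h : vec n -> R) (c : R -> vec n) t :
  (forall i, continuous (fun s => c s i) t) ->
  (forall eps, eps > 0 -> exists delta, delta > 0 /\ forall y,
     norm1 (vsub y (c t)) < delta -> Rabs (h y - h (c t)) < eps) ->
  continuous (fun s => h (c s)) t.
Proof.
move=> hc hh; apply/continuousP => eps he.
have [d [hd hd']] := hh eps he; have hn := pos_INR n.
have he' : d / (INR n + 1) > 0 by apply: Rdiv_lt_0_compat; lra.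
have [i r r' hr hP s hs|i|d1 [hd1 h1]] := finite_delta n (fun j r => forall s, Rabs (s - t) < r ->
   Rabs (c s j - c t j) < d / (INR n + 1)).
- by apply: hP; lra.
- exact: (proj1 (continuousP _ _) (hc i)).
exists d1; split=> // s hs; apply: hd'.
apply: Rle_lt_trans (norm1_le_const _ _ (d / (INR n + 1)) _) _.
  by move=> i; left; apply: h1.
have -> : INR n * (d / (INR n + 1)) = d - d / (INR n + 1) by field; lra.
lra.
Qed.

(** The tail after index [k] is at most [2 * M * (/2) ^ k], so the intervals of this radius around
    [a k] are nested; the limit is the supremum of their left ends. *)
Lemma geometric_limit (a : nat -> R) M :
  (forall k, Rabs (a (S k) - a k) <= M * (/2) ^ k) ->
  exists l, forall k, Rabs (l - a k) <= 2 * M * (/2) ^ k.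
Proof.
move=> h.
pose b k := a k - 2 * M * (/2) ^ k; pose c k := a k + 2 * M * (/2) ^ k.
have hM : 0 <= M by have := h O; have := Rabs_pos (a 1%nat - a O) => /=; lra.
have hp k : 0 <= M * (/2) ^ k by apply: Rmult_le_pos => //; apply: pow_le; lra.
have hb k m : b k <= b (k + m)%coq_nat.
  elim: m => [|m IH]; first by rewrite Nat.add_0_r; lra.
  apply: Rle_trans IH _; rewrite Nat.add_succ_r /b.
  have := h (k + m)%coq_nat; have := Rle_abs (- (a (S (k + m)%coq_nat) - a (k + m)%coq_nat)).
  by rewrite Rabs_Ropp /=; lra.
have hc k m : c (k + m)%coq_nat <= c k.
  elim: m => [|m IH]; first by rewrite Nat.add_0_r; lra.
  apply: Rle_trans _ IH; rewrite Nat.add_succ_r /c.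
  have := h (k + m)%coq_nat; have := Rle_abs (a (S (k + m)%coq_nat) - a (k + m)%coq_nat).
  by rewrite /=; lra.
have hbc k m : b k <= c m.
  apply: Rle_trans (hb k m) (Rle_trans _ _ _ _ (hc m k)).
  by rewrite Nat.add_comm /b /c; have := hp (m + k)%coq_nat; lra.
have [||l [hl1 hl2]] := completeness (fun x => exists k, x = b k).
- by exists (c O) => x [k ->].
- by exists (b O), O.
exists l => k.
have h1 : b k <= l by apply: hl1; exists k.
have h2 : l <= c k by apply: hl2 => x [m ->].
by apply: Rabs_le; rewrite /b /c in h1 h2; lra.
Qed.

Lemma eq0_of_geometric a C : (forall k, Rabs a <= C * (/2) ^ k) -> a = 0.
Proof.
move=> h; apply: NNPP => ha.
have hC : 0 < C + 1 by have := h O; have := Rabs_pos a => /=; lra.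
have hp := Rabs_pos_lt a ha.
have h2 : Rabs (/2) < 1 by rewrite Rabs_pos_eq; lra.
have h0 : 0 < Rabs a / (C + 1) by apply: Rdiv_lt_0_compat; lra.
have [N hN] := pow_lt_1_zero (/2) h2 _ h0.
have := hN N (Nat.le_refl _); rewrite Rabs_pos_eq; last by apply: pow_le; lra.
move=> h1; have {}h2 := h N.
have h3 : Rabs a / (C + 1) * (C + 1) = Rabs a by field; lra.
have h4 : 0 < (/2) ^ N by apply: pow_lt; lra.
nra.
Qed.

(** Integrating the weight [exp (l * s)] gains a factor [1 / l]; this gain is what makes Picard
    iteration contract on the whole line. *)
Lemma exp_growth_forward (P P' : R -> R) M l t : 0 < l -> 0 <= M -> 0 <= t -> P 0 = 0 ->
  (forall s, is_derive P s (P' s)) -> (forall s, 0 <= s -> P' s <= M * exp (l * s)) ->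
  P t <= M / l * exp (l * t).
Proof.
move=> hl hM ht h0 hP hM'.
have hM0 : 0 <= M / l by apply: Rdiv_le_0_compat.
pose g s := P s - M / l * exp (l * s).
pose g' s := P' s - M * exp (l * s).
have hg s : 0 <= s <= t -> is_derive g s (g' s) /\ g' s <= 0.
  move=> hs; rewrite /g /g'; split; last by have := hM' s (proj1 hs); lra.
  auto_derive; first by exists (P' s).
  by rewrite (is_derive_unique (fun x => P x) _ _ (hP s)); field; lra.
have := decreasing_le g g' t ht hg.
by rewrite /g h0 Rmult_0_r exp_0; lra.
Qed.

Lemma exp_growth (P P' : R -> R) M l t : 0 < l -> 0 <= M -> P 0 = 0 ->
  (forall s, is_derive P s (P' s)) -> (forall s, Rabs (P' s) <= M * exp (l * Rabs s)) ->
  Rabs (P t) <= M / l * exp (l * Rabs t).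
Proof.
move=> hl hM h0 hP hM'.
have hop (Q Q' : R -> R) s : is_derive Q s (Q' s) -> is_derive (fun x => - Q x) s (- Q' s).
  by move=> h; apply: (is_derive_opp Q s (Q' s)).
case: (Rle_dec 0 t) => ht.
  rewrite (Rabs_pos_eq t) //; apply: Rabs_le; split.
    have := exp_growth_forward (fun s => - P s) (fun s => - P' s) M l t hl hM ht.
    rewrite h0 => H; apply: Ropp_le_cancel; rewrite Ropp_involutive; apply: H => [|s|s hs]; first ring.
      exact: hop.
    have := hM' s; rewrite (Rabs_pos_eq s) // => h; have := Rle_abs (- P' s).
    by rewrite Rabs_Ropp; lra.
  apply: (exp_growth_forward P P') => // s hs.
  by have := hM' s; rewrite (Rabs_pos_eq s) // => h; have := Rle_abs (P' s); lra.
rewrite (Rabs_left t); last lra.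
have ht' : 0 <= - t by lra.
apply: Rabs_le; split.
  have := exp_growth_forward (fun s => - P (- s)) (fun s => P' (- s)) M l (- t) hl hM ht'.
  rewrite Ropp_involutive Ropp_0 h0 => H; apply: Ropp_le_cancel; rewrite Ropp_involutive.
  apply: H => [|s|s hs]; first ring.
    by rewrite -[P' _]Ropp_involutive; apply: (hop (fun x => P (- x)) (fun s => - P' (- s))); apply: is_derive_reverse.
  have := hM' (- s); rewrite Rabs_Ropp (Rabs_pos_eq s) // => h; have := Rle_abs (P' (- s)).
  lra.
have := exp_growth_forward (fun s => P (- s)) (fun s => - P' (- s)) M l (- t) hl hM ht'.
rewrite Ropp_involutive Ropp_0 h0; apply=> // [s|s hs]; first exact: is_derive_reverse.
have := hM' (- s); rewrite Rabs_Ropp (Rabs_pos_eq s) // => h; have := Rle_abs (- P' (- s)).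
by rewrite Rabs_Ropp; lra.
Qed.

Lemma is_derive_RInt0 (f : R -> R) : (forall s, continuous f s) ->
  forall t, is_derive (fun t => RInt f 0 t) t (f t).
Proof.
move=> hf t; apply: (is_derive_RInt f (fun t => RInt f 0 t) 0) => //.
by apply: filter_forall => s; apply: RInt_correct; apply: ex_RInt_continuous.
Qed.

Definition picard_iter n (G : R -> vec n -> vec n) (x0 : vec n) : nat -> R -> vec n :=
  fix iter k := match k with
  | O => fun _ => x0
  | S k' => fun t i => x0 i + RInt (fun s => G s (iter k' s) i) 0 t
  end.

(** Distances are measured with the weight [exp (l * |t|)], under which the integral operator
    contracts by one half for all times at once, so a global solution comes without gluing local
    ones. The right-hand side depends on time so that the variational equation is covered too, and
    boundedness is asked only along the initial guess [x0], which a linear equation can satisfy. *)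
Lemma picard n (G : R -> vec n -> vec n) x0 B B0 : 0 <= B -> 
  (forall u : R -> vec n, (forall i t, continuous (fun s => u s i) t) ->
     forall i t, continuous (fun s => G s (u s) i) t) ->
  (forall t x y i, Rabs (G t x i - G t y i) <= B * norm1 (vsub x y)) ->
  0 <= B0 -> (forall t i, Rabs (G t x0 i) <= B0) ->
  exists u : R -> vec n, u 0 = x0 /\ forall t i, is_derive (fun s => u s i) t (G t (u t) i).
Proof.
move=> hB hGc hGL hB0 hG0; have hn := pos_INR n.
(* The rate [l] is chosen so that the contraction factor [B * INR n / l] is at most [1 / 2]. *)
pose u := picard_iter n G x0; pose l := 2 * B * INR n + 1.
have hl : 1 <= l by rewrite /l; nra.
have hBn : B * INR n / l <= /2.
  have h : B * INR n / l * l = B * INR n by field; lra.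
  by apply: (Rmult_le_reg_r l); [lra|rewrite h /l; lra].
have huc k : forall i t, continuous (fun s => u k s i) t.
  elim: k => [|k IH] i t /=; first exact: continuous_const.
  apply: (continuous_plus (V := R_NormedModule)); first exact: continuous_const.
  apply: ex_derive_continuous; eexists; apply: (is_derive_RInt0 (fun s => G s (u k s) i)).
  by move=> s; apply: hGc.
have hstep (v w : R -> vec n) D : 0 <= D -> (forall i t, continuous (fun s => v s i) t) ->
    (forall i t, continuous (fun s => w s i) t) ->
    (forall t i, Rabs (v t i - w t i) <= D * exp (l * Rabs t)) ->
    forall t i, Rabs (RInt (fun s => G s (v s) i) 0 t - RInt (fun s => G s (w s) i) 0 t)
       <= D / 2 * exp (l * Rabs t).
  move=> hD hv hw hvw t i.
  apply: (Rle_trans _ (D * (B * INR n) / l * exp (l * Rabs t))); last first.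
    apply: Rmult_le_compat_r; first by left; apply: exp_pos.
    have -> : D * (B * INR n) / l = D * (B * INR n / l) by rewrite /Rdiv Rmult_assoc.
    have := Rmult_le_compat_l _ _ _ hD hBn; lra.
  apply: (exp_growth (fun t => RInt (fun s => G s (v s) i) 0 t - RInt (fun s => G s (w s) i) 0 t)
    (fun t => G t (v t) i - G t (w t) i)); [lra|by apply: Rmult_le_pos => //; apply: Rmult_le_pos| | |].
  - by rewrite !RInt_point; exact: Rminus_diag.
  - move=> s; apply: (is_derive_minus (K := R_AbsRing) (V := R_NormedModule)).
      by apply: (is_derive_RInt0 (fun s => G s (v s) i)) => r; apply: hGc.
    by apply: (is_derive_RInt0 (fun s => G s (w s) i)) => r; apply: hGc.
  - move=> s; apply: Rle_trans (hGL _ _ _ _) _.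
    have := norm1_le_const _ (vsub (v s) (w s)) _ (hvw s) => h.
    have := Rmult_le_compat_l _ _ _ hB h; lra.
have hdiff k : forall t i, Rabs (u (S k) t i - u k t i) <= B0 * (/2) ^ k * exp (l * Rabs t).
  elim: k => [|k IH] t i.
    rewrite /= Rmult_1_r.
    have -> : x0 i + RInt (fun s => G s x0 i) 0 t - x0 i = RInt (fun s => G s x0 i) 0 t by ring.
    apply: (Rle_trans _ (B0 / l * exp (l * Rabs t))).
      apply: (exp_growth (fun t => RInt (fun s => G s x0 i) 0 t) (fun t => G t x0 i)) => //; [lra| | |].
      + exact: RInt_point.
      + by move=> s; apply: (is_derive_RInt0 (fun s => G s x0 i)) => r;
           apply: (hGc (fun _ => x0)) => j q; apply: continuous_const.
      + move=> s; apply: Rle_trans (hG0 s i) _.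
        have : 1 <= exp (l * Rabs s); last by nra.
        have := Rabs_pos s; rewrite -exp_0; case=> [h|<-]; last by rewrite Rmult_0_r exp_0; lra.
        by left; apply: exp_increasing; nra.
    apply: Rmult_le_compat_r; first by left; apply: exp_pos.
    apply: (Rmult_le_reg_r l); first lra.
    have -> : B0 / l * l = B0 by field; lra.
    nra.
  have -> : u (S (S k)) t i - u (S k) t i =
    RInt (fun s => G s (u (S k) s) i) 0 t - RInt (fun s => G s (u k s) i) 0 t by rewrite /=; ring.
  have -> : B0 * (/2) ^ S k = B0 * (/2) ^ k / 2 by rewrite /=; field.
  apply: hstep => //.
  by apply: Rmult_le_pos => //; apply: pow_le; lra.
have [v hv] : exists v : R -> vec n, forall t i k,
    Rabs (v t i - u k t i) <= 2 * B0 * (/2) ^ k * exp (l * Rabs t).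
  apply: (functional_choice (fun t (v : vec n) => forall i k,
     Rabs (v i - u k t i) <= 2 * B0 * (/2) ^ k * exp (l * Rabs t))) => t.
  apply: (functional_choice (fun i (v : R) => forall k,
     Rabs (v - u k t i) <= 2 * B0 * (/2) ^ k * exp (l * Rabs t))) => i.
  have [k|y hy] := geometric_limit (fun k => u k t i) (B0 * exp (l * Rabs t)).
    by have := hdiff k t i; lra.
  by exists y => k; have := hy k; lra.
have hvc i t : continuous (fun s => v s i) t.
  apply/continuousP => eps he.
  (* Three-epsilon argument: on [|s| <= |t| + 1] the weight is bounded, so the iterates converge
     uniformly there, and one continuous iterate transfers its continuity to [v]. *)
  pose X := 2 * B0 * exp (l * (Rabs t + 1)).
  have hX : 0 <= X by apply: Rmult_le_pos; [lra|left; apply: exp_pos].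
  have h12 : Rabs (/2) < 1 by rewrite Rabs_pos_eq; lra.
  have h0 : 0 < eps / 3 / (X + 1) by apply: Rdiv_lt_0_compat; lra.
  have [k hk] := pow_lt_1_zero (/2) h12 _ h0.
  have := hk k (Nat.le_refl _); rewrite Rabs_pos_eq => [{}hk|]; last by apply: pow_le; lra.
  have hk' : X * (/2) ^ k < eps / 3.
    have h3 : eps / 3 / (X + 1) * (X + 1) = eps / 3 by field; lra.
    have h4 : 0 < (/2) ^ k by apply: pow_lt; lra.
    nra.
  have hb s : Rabs s <= Rabs t + 1 -> Rabs (v s i - u k s i) < eps / 3.
    move=> hs; apply: Rle_lt_trans (hv s i k) (Rle_lt_trans _ _ _ _ hk').
    have -> : X * (/2) ^ k = 2 * B0 * (/2) ^ k * exp (l * (Rabs t + 1)) by rewrite /X; ring.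
    apply: Rmult_le_compat_l.
      by apply: Rmult_le_pos; [lra|apply: pow_le; lra].
    have : l * Rabs s <= l * (Rabs t + 1) by nra.
    by case=> [h|->]; [left; apply: exp_increasing|right].
  have [|d [hd hcont]] := proj1 (continuousP _ _) (huc k i t) (eps / 3); first lra.
  exists (Rmin d 1); split=> [|s hs]; first by apply: Rmin_pos; lra.
  have hs1 := Rlt_le_trans _ _ _ hs (Rmin_l _ _).
  have hs2 := Rlt_le_trans _ _ _ hs (Rmin_r _ _).
  have h1 := hcont s hs1.
  have h2 := hb s; have h3 := hb t ltac:(lra).
  have hs3 : Rabs s <= Rabs t + 1.
    have := Rabs_triang (s - t) t; have -> : s - t + t = s by ring.
    lra.
  have {h2} h2 := h2 hs3.
  have -> : v s i - v t i = (v s i - u k s i) + (u k s i - u k t i) + - (v t i - u k t i) by ring.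
  have := Rabs_triang (v s i - u k s i + (u k s i - u k t i)) (- (v t i - u k t i)).
  have := Rabs_triang (v s i - u k s i) (u k s i - u k t i).
  rewrite Rabs_Ropp; lra.
have hint t i : v t i = x0 i + RInt (fun s => G s (v s) i) 0 t.
  (* The gap in the integral equation is compared with the exact relation between [u (S k)] and
     [u k]; both discrepancies are of order [(/2) ^ k], so the gap vanishes. *)
  apply: Rminus_diag_uniq; apply: (eq0_of_geometric _ (2 * B0 * exp (l * Rabs t))) => k.
  have h1 := hv t i (S k).
  have h2 : Rabs (RInt (fun s => G s (v s) i) 0 t - RInt (fun s => G s (u k s) i) 0 t)
     <= 2 * B0 * (/2) ^ k / 2 * exp (l * Rabs t).
    apply: hstep => //.
    by apply: Rmult_le_pos; [lra|apply: pow_le; lra].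
  have -> : v t i - (x0 i + RInt (fun s => G s (v s) i) 0 t) =
    (v t i - u (S k) t i) - (RInt (fun s => G s (v s) i) 0 t - RInt (fun s => G s (u k s) i) 0 t).
    by rewrite /=; ring.
  have := Rabs_triang (v t i - u (S k) t i) (- (RInt (fun s => G s (v s) i) 0 t - RInt (fun s => G s (u k s) i) 0 t)).
  rewrite Rabs_Ropp -/(Rminus _ _) => h3; apply: Rle_trans h3 _.
  have h4 : 0 <= (/2) ^ k * exp (l * Rabs t).
    by apply: Rmult_le_pos; [apply: pow_le; lra|left; apply: exp_pos].
  have h5 : (/2) ^ S k = /2 * (/2) ^ k by [].
  rewrite h5 in h1; lra.
exists v; split.
  by apply: functional_extensionality => i; rewrite hint RInt_point; apply: Rplus_0_r.
move=> t i.
apply: (is_derive_ext (fun s => x0 i + RInt (fun s => G s (v s) i) 0 s)) => [s|]; first by rewrite -hint.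
rewrite -[G t (v t) i]Rplus_0_l.
apply: (is_derive_plus (K := R_AbsRing) (V := R_NormedModule)); first exact: is_derive_const.
by apply: (is_derive_RInt0 (fun s => G s (v s) i)) => s; apply: hGc.
Qed.

(** * The flow of a bounded field with bounded, uniformly continuous derivative *)

Record regular_field {n} (F : vec n -> vec n) (DF : vec n -> mat n n) (B : R) : Prop := {
  rf_ge0 : 0 <= B;
  rf_diff : forall x i, curve_diff_at (fun y => F y i) x (DF x i);
  rf_bound : forall x i, Rabs (F x i) <= B;
  rf_bound' : forall x i j, Rabs (DF x i j) <= B;
  rf_ucont : forall eps, eps > 0 -> exists delta, delta > 0 /\
    forall x y, norm1 (vsub y x) < delta -> forall i j, Rabs (DF y i j - DF x i j) < eps
}.

Record is_flow {n} (F : vec n -> vec n) (Phi : R -> vec n -> vec n) : Prop := {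
  flow0 : forall x, Phi 0 x = x;
  flow_derive : forall x t i, is_derive (fun s => Phi s x i) t (F (Phi t x) i)
}.

(** The variational equation along the flow, with the identity as initial matrix. That [J] is the
    derivative of [Phi] in the initial point is proved in [flow_curve_diff]. *)
Record is_jacobian {n} (DF : vec n -> mat n n) (Phi : R -> vec n -> vec n)
    (J : R -> vec n -> mat n n) : Prop := {
  jac0 : forall x i j, J 0 x i j = if i == j then 1 else 0;
  jac_derive : forall x t i j, is_derive (fun s => J s x i j) t
    (\rsum_(k < n) (DF (Phi t x) i k * J t x k j))
}.

Lemma vadd_vsub n (x y : vec n) : vadd x (vsub y x) = y.
Proof. by apply: functional_extensionality => j; rewrite /vadd /vsub; ring. Qed.

Lemma is_derive_sub (f g : R -> R) t a b : is_derive f t a -> is_derive g t b ->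
  is_derive (fun s => f s - g s) t (a - b).
Proof. exact: (is_derive_minus (K := R_AbsRing) (V := R_NormedModule)). Qed.

Section RegularField.
Context {n : nat} {F : vec n -> vec n} {DF : vec n -> mat n n} {B : R}.
Hypothesis (hF : regular_field F DF B).

Lemma field_lipschitz x y i : Rabs (F x i - F y i) <= B * norm1 (vsub x y).
Proof.
have [s _|s [_ h]] := line_MVT n (fun y => F y i) (fun y => DF y i) y (vsub x y).
  exact (rf_diff _ _ _ hF _ _).
rewrite vadd_vsub in h; rewrite h; apply: rsum_mul_le => j; exact: (rf_bound' _ _ _ hF).
Qed.

(** The radius [delta] does not depend on the base point, by uniform continuity of [DF]; this
    matters because the expansion is used at the moving point [Phi s x]. *)
Lemma field_taylor eps : eps > 0 -> exists delta, delta > 0 /\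
  forall x y, norm1 (vsub y x) < delta -> forall i,
    Rabs (F y i - F x i - \rsum_(j < n) (DF x i j * vsub y x j)) <= eps * norm1 (vsub y x).
Proof.
move=> he; have [d [hd h]] := rf_ucont _ _ _ hF eps he.
exists d; split=> // x y hxy i.
have [s _|s [hs hl]] := line_MVT n (fun y => F y i) (fun y => DF y i) x (vsub y x).
  exact (rf_diff _ _ _ hF _ _).
rewrite vadd_vsub in hl; rewrite hl -rsum_minus.
rewrite (rsum_ext _ _ (fun j => (DF (line x (vsub y x) s) i j - DF x i j) * vsub y x j)); last by move=> j; ring.
apply: rsum_mul_le => j; left; apply: h; rewrite norm1_line Rabs_pos_eq; last lra.
by have := norm1_ge0 n (vsub y x); nra.
Qed.

Lemma flow_exists : exists Phi, is_flow F Phi.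
Proof.
have hB := rf_ge0 _ _ _ hF.
have [Phi h] : exists Phi : vec n -> R -> vec n, forall x, Phi x 0 = x /\
    forall t i, is_derive (fun s => Phi x s i) t (F (Phi x t) i).
  apply: (functional_choice (fun x (u : R -> vec n) => u 0 = x /\
    forall t i, is_derive (fun s => u s i) t (F (u t) i))) => x.
  apply: (picard n (fun _ => F) x B B) => // [u hu i t|t y z i|t i].
  - apply: (continuous_comp_vec n (fun y => F y i) u) => [j|eps he]; first exact: hu.
    exists (eps / (B + 1)); split=> [|y hy]; first by apply: Rdiv_lt_0_compat; lra.
    apply: Rle_lt_trans (field_lipschitz _ _ _) _.
    have -> : eps = (B + 1) * (eps / (B + 1)) by field; lra.
    by have := norm1_ge0 n (vsub y (u t)); nra.
  - exact: field_lipschitz.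
  - exact: (rf_bound _ _ _ hF).
by exists (fun t x => Phi x t); split=> [x|x t i]; [exact: (proj1 (h x))|exact: (proj2 (h x))].
Qed.

(** The one-sided form is needed for solutions of the original equation, which are given for
    nonnegative times only. *)
Lemma solution_unique_forward (u v : R -> vec n) :
  (forall t, 0 <= t -> forall i, is_derive (fun s => u s i) t (F (u t) i)) ->
  (forall t, 0 <= t -> forall i, is_derive (fun s => v s i) t (F (v t) i)) ->
  u 0 = v 0 -> forall t, 0 <= t -> u t = v t.
Proof.
move=> hu hv h0 t ht; apply: NNPP => hn; have := normsq_gt0 _ _ _ hn.
have hs s : 0 <= s <= t -> forall i, is_derive (fun r => vsub (u r) (v r) i) s (F (u s) i - F (v s) i) /\
    Rabs (F (u s) i - F (v s) i) <= B * norm1 (vsub (u s) (v s)) + 0.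
  move=> hs i; split; last by rewrite Rplus_0_r; apply: field_lipschitz.
  by apply: (is_derive_sub (fun r => u r i) (fun r => v r i)); [apply: hu|apply: hv]; lra.
have := gronwall_forward n (fun s => vsub (u s) (v s)) (fun s i => F (u s) i - F (v s) i)
  B 0 t (rf_ge0 _ _ _ hF) (Rle_refl 0) ht hs.
have -> : normsq (vsub (u 0) (v 0)) = 0.
  by rewrite h0; apply: big1 => i _; rewrite /vsub; ring.
rewrite !(Rmult_0_r, Rmult_0_l, Rplus_0_l); lra.
Qed.

Lemma solution_unique (u v : R -> vec n) :
  (forall t i, is_derive (fun s => u s i) t (F (u t) i)) ->
  (forall t i, is_derive (fun s => v s i) t (F (v t) i)) ->
  u 0 = v 0 -> forall t, u t = v t.
Proof.
move=> hu hv h0 t; apply: NNPP => hn; have := normsq_gt0 _ _ _ hn.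
have := gronwall n (fun s => vsub (u s) (v s)) (fun s i => F (u s) i - F (v s) i) B 0 (Rabs t)
  (rf_ge0 _ _ _ hF) (Rle_refl 0) _ t (Rle_refl _).
have -> : normsq (vsub (u 0) (v 0)) = 0.
  by rewrite h0; apply: big1 => i _; rewrite /vsub; ring.
rewrite !(Rmult_0_r, Rmult_0_l, Rplus_0_l) => h h'.
suff : normsq (vsub (u t) (v t)) <= 0 by lra.
apply: h => s _ i; split; last by rewrite Rplus_0_r; apply: field_lipschitz.
by apply: (is_derive_sub (fun r => u r i) (fun r => v r i)).
Qed.

Context {Phi : R -> vec n -> vec n}.
Hypothesis (hPhi : is_flow F Phi).

(** As functions of [s], both sides solve the equation with value [Phi t x] at [0]. *)
Lemma flow_group s t x : Phi s (Phi t x) = Phi (s + t) x.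
Proof.
apply: (solution_unique (fun s => Phi s (Phi t x)) (fun s => Phi (s + t) x)) => [r i|r i|].
- exact: (flow_derive _ _ hPhi).
- have h := flow_derive _ _ hPhi x (r + t) i.
  have := is_derive_comp (fun r => Phi r x i) (fun r => r + t) r _ 1 h.
  rewrite /scal /= /mult /= Rmult_1_l; apply.
  by auto_derive => //; ring.
by rewrite (flow0 _ _ hPhi) Rplus_0_l.
Qed.

Lemma flow_continuous x t i : continuous (fun s => Phi s x i) t.
Proof. by apply: ex_derive_continuous; eexists; apply: (flow_derive _ _ hPhi). Qed.

Lemma flow_displacement x t i : Rabs (Phi t x i - x i) <= B * Rabs t.
Proof.
have [s _|s _|s [_ h]] := MVT_gen (fun s => Phi s x i) 0 t (fun s => F (Phi s x) i).
- exact: (flow_derive _ _ hPhi).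
- by apply/continuity_pt_filterlim; apply: flow_continuous.
rewrite (flow0 _ _ hPhi) Rminus_0_r in h; rewrite h Rabs_mult.
by apply: Rmult_le_compat_r; [exact: Rabs_pos|exact: (rf_bound _ _ _ hF)].
Qed.

(** Gronwall comparison, without defect, of an orbit with the constant solution [p]. The bound at
    negative times is the one that later fixes the rate [a]. *)
Lemma flow_expansion p t x : equilibrium F p ->
  normsq (vsub (Phi t x) p) <= normsq (vsub x p) * exp ((2 * B * INR n + 1) * Rabs t).
Proof.
move=> hp.
have := gronwall n (fun s => vsub (Phi s x) p) (fun s i => F (Phi s x) i) B 0 (Rabs t)
  (rf_ge0 _ _ _ hF) (Rle_refl 0) _ t (Rle_refl _).
rewrite (flow0 _ _ hPhi) !(Rmult_0_r, Rmult_0_l, Rplus_0_r); apply=> s _ i; split.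
  rewrite -[F _ i]Rminus_0_r.
  by apply: (is_derive_sub (fun r => Phi r x i) (fun r => p i)); [exact: (flow_derive _ _ hPhi)|exact: is_derive_const].
by rewrite Rplus_0_r -[F _ i]Rminus_0_r -(hp i); apply: field_lipschitz.
Qed.

Lemma flow_lipschitz T : 0 <= T -> exists E, E > 0 /\ forall x y t, Rabs t <= T ->
  norm1 (vsub (Phi t x) (Phi t y)) <= E * norm1 (vsub x y).
Proof.
move=> hT; have [E [hE h]] := gronwall_norm1 n B T (rf_ge0 _ _ _ hF) hT.
exists E; split=> // x y t ht.
have := h (fun s => vsub (Phi s x) (Phi s y)) (fun s i => F (Phi s x) i - F (Phi s y) i) 0 (Rle_refl 0) _ t ht.
rewrite Rplus_0_r !(flow0 _ _ hPhi); apply=> s _ i; split.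
  by apply: (is_derive_sub (fun r => Phi r x i) (fun r => Phi r y i)); exact: (flow_derive _ _ hPhi).
by rewrite Rplus_0_r; apply: field_lipschitz.
Qed.

Lemma flow_equilibrium p t : equilibrium F p -> Phi t p = p.
Proof.
move=> hp; apply: NNPP => hn; have := normsq_gt0 _ _ _ hn.
have := flow_expansion p t p hp.
have -> : normsq (vsub p p) = 0 by apply: big1 => i _; rewrite /vsub; ring.
lra.
Qed.

Lemma DF_flow_continuous x i k t : continuous (fun s => DF (Phi s x) i k) t.
Proof.
apply: (continuous_comp_vec n (fun y => DF y i k) (fun s => Phi s x)) => [j|eps he].
  exact: flow_continuous.
have [d [hd h]] := rf_ucont _ _ _ hF eps he.
by exists d; split=> // y hy; apply: h.
Qed.

(** Each column solves a linear equation with bounded coefficients, to which [picard] applies; the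
    choice is made over pairs of a point and a column index. *)
Lemma jacobian_exists : exists J, is_jacobian DF Phi J.
Proof.
have hB := rf_ge0 _ _ _ hF; have hn := pos_INR n.
have [J h] : exists J : vec n * 'I_n -> R -> vec n, forall xj,
    J xj 0 = (fun i => if i == xj.2 then 1 else 0) /\
    forall t i, is_derive (fun s => J xj s i) t
      (\rsum_(k < n) (DF (Phi t xj.1) i k * J xj t k)).
  apply: (functional_choice (fun (xj : vec n * 'I_n) (u : R -> vec n) =>
    u 0 = (fun i => if i == xj.2 then 1 else 0) /\
    forall t i, is_derive (fun s => u s i) t
      (\rsum_(k < n) (DF (Phi t xj.1) i k * u t k)))) => -[x j] /=.
  apply: (picard n (fun t v i => \rsum_(k < n) (DF (Phi t x) i k * v k)) _ B (INR n * B)) =>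
    // [u hu i t|t y z i||t i].
  - apply: (continuous_rsum _ _ (fun s k => DF (Phi s x) i k * u s k)) => k.
    apply: (continuous_mult (fun s => DF (Phi s x) i k) (fun s => u s k)); last exact: hu.
    exact: DF_flow_continuous.
  - rewrite -rsum_minus (rsum_ext _ _ (fun k => DF (Phi t x) i k * (vsub y z k))).
      by apply: rsum_mul_le => k; apply: (rf_bound' _ _ _ hF).
    by move=> k; rewrite /vsub; ring.
  - exact: Rmult_le_pos.
  - rewrite rsum_delta; apply: Rle_trans (rf_bound' _ _ _ hF _ _ _) _.
    have : INR 1 <= INR n by apply: le_INR; case: (n) j => [[]//|m _]; apply: le_n_S; apply: Nat.le_0_l.
    by rewrite /=; nra.
exists (fun t x i j => J (x, j) t i); split=> [x i j|x t i j].
  by rewrite (proj1 (h (x, j))).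
exact: (proj2 (h (x, j))).
Qed.

Context {J : R -> vec n -> mat n n}.
Hypothesis (hJ : is_jacobian DF Phi J).

Lemma jacobian_continuous x i j t : continuous (fun s => J s x i j) t.
Proof. by apply: ex_derive_continuous; eexists; apply: (jac_derive _ _ _ hJ). Qed.

Lemma norm1_delta (j : 'I_n) : norm1 (fun i => if i == j then 1 else 0) = 1.
Proof.
rewrite /norm1 -[RHS](rsum_delta n (fun _ => 1) j); apply: rsum_ext => i.
by case: (i == j) => /=; rewrite ?Rabs_R0 ?Rabs_R1; ring.
Qed.

Lemma jacobian_bounded T : 0 <= T -> exists E, E > 0 /\ forall x t j, Rabs t <= T ->
  norm1 (fun i => J t x i j) <= E.
Proof.
move=> hT; have [E [hE h]] := gronwall_norm1 n B T (rf_ge0 _ _ _ hF) hT.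
exists E; split=> // x t j ht.
have := h (fun s i => J s x i j) (fun s i => \rsum_(k < n) (DF (Phi s x) i k * J s x k j))
  0 (Rle_refl 0) _ t ht.
have -> : norm1 (fun i => J 0 x i j) = 1.
  rewrite -(norm1_delta j); congr norm1; apply: functional_extensionality => i.
  exact: (jac0 _ _ _ hJ).
rewrite Rplus_0_r Rmult_1_r; apply=> s _ i; split; first exact: (jac_derive _ _ _ hJ).
by rewrite Rplus_0_r; apply: rsum_mul_le => k; apply: (rf_bound' _ _ _ hF).
Qed.

(** The difference of corresponding columns at [y] and [x] solves the linear equation along
    [Phi s y] with defect [(DF (Phi s y) - DF (Phi s x)) * J s x] and zero initial value; the defect
    is at most [e * E1]. *)
Lemma jacobian_ucont T eps : 0 <= T -> eps > 0 -> exists delta, delta > 0 /\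
  forall x y t, Rabs t <= T -> norm1 (vsub y x) < delta ->
  forall i j, Rabs (J t y i j - J t x i j) < eps.
Proof.
move=> hT he; have [E [hE h]] := gronwall_norm1 n B T (rf_ge0 _ _ _ hF) hT.
have [E1 [hE1 h1]] := jacobian_bounded T hT.
have [E2 [hE2 h2]] := flow_lipschitz T hT.
pose e := eps / (2 * E * E1); have hEE : 0 < E * E1 by apply: Rmult_lt_0_compat.
have he' : e > 0 by apply: Rdiv_lt_0_compat; nra.
have [d [hd h3]] := rf_ucont _ _ _ hF e he'.
exists (d / E2); split=> [|x y t ht hxy i j]; first exact: Rdiv_lt_0_compat.
have hee : 0 <= e * E1 by nra.
have hDF s : Rabs s <= T -> forall i k, Rabs (DF (Phi s y) i k - DF (Phi s x) i k) <= e.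
  move=> hs i' k; left; apply: h3; apply: Rle_lt_trans (h2 _ _ _ hs) _.
  have -> : d = E2 * (d / E2) by field; lra.
  exact: Rmult_lt_compat_l.
have := h (fun s i => J s y i j - J s x i j)
  (fun s i => \rsum_(k < n) (DF (Phi s y) i k * J s y k j) - \rsum_(k < n) (DF (Phi s x) i k * J s x k j))
  (e * E1) hee _ t ht.
have -> : norm1 (fun i => J 0 y i j - J 0 x i j) = 0.
  by apply: big1 => k _; rewrite !(jac0 _ _ _ hJ) Rminus_diag Rabs_R0.
rewrite Rplus_0_l => H.
have {}H : norm1 (fun i => J t y i j - J t x i j) <= E * (e * E1).
  apply: H => s hs k; split.
    by apply: (is_derive_sub (fun s => J s y k j) (fun s => J s x k j)); exact: (jac_derive _ _ _ hJ).
  rewrite -rsum_minus.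
  rewrite (rsum_ext _ _ (fun l => DF (Phi s y) k l * (J s y l j - J s x l j) +
     (DF (Phi s y) k l - DF (Phi s x) k l) * J s x l j)); last by move=> l; ring.
  rewrite rsum_plus; apply: Rle_trans (Rabs_triang _ _) _; apply: Rplus_le_compat.
    by apply: (rsum_mul_le _ _ (fun l => J s y l j - J s x l j)) => l; apply: (rf_bound' _ _ _ hF).
  apply: Rle_trans (rsum_mul_le _ _ (fun l => J s x l j) e (hDF s hs k)) _.
  by apply: Rmult_le_compat_l; [lra|apply: h1].
have := abs_le_norm1 n (fun i => J t y i j - J t x i j) i => /= h4.
have h5 : E * (e * E1) = eps / 2 by rewrite /e; field; split; lra.
lra.
Qed.

(** The error [u = Phi y - Phi x - J (y - x)] starts at zero and satisfies [u' = DF (Phi x) u + R],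
    where [R] is the Taylor remainder of [F] between the two orbits. Gronwall then bounds [u] by a
    small multiple of [|y - x|]. *)
Lemma flow_curve_diff t x i : curve_diff_at (fun y => Phi t y i) x (J t x i).
Proof.
apply: curve_diff_of_little_o => eps he.
have hT := Rabs_pos t.
have [E [hE h]] := gronwall_norm1 n B (Rabs t) (rf_ge0 _ _ _ hF) hT.
have [E2 [hE2 h2]] := flow_lipschitz (Rabs t) hT.
(* The remainder is at most [e * E2 * norm1 k], as the orbits separate at most by the factor [E2],
   and Gronwall multiplies it by [E]. *)
pose e := eps / (E * E2).
have he' : e > 0 by apply: Rdiv_lt_0_compat => //; apply: Rmult_lt_0_compat.
have [d [hd h3]] := field_taylor e he'.
exists (d / E2); split=> [|y hy]; first exact: Rdiv_lt_0_compat.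
set k := vsub y x in hy *; have hk := norm1_ge0 n k.
pose u s i := Phi s y i - Phi s x i - \rsum_(j < n) (J s x i j * k j).
pose u' s i := F (Phi s y) i - F (Phi s x) i -
  \rsum_(j < n) (\rsum_(l < n) (DF (Phi s x) i l * J s x l j) * k j).
have := h u u' (e * (E2 * norm1 k)) _ _ t (Rle_refl _).
have -> : norm1 (u 0) = 0.
  apply: big1 => l _; rewrite /u !(flow0 _ _ hPhi).
  rewrite (rsum_ext _ _ (fun j => k j * (if j == l then 1 else 0))).
    by rewrite rsum_delta /k /vsub Rminus_diag Rabs_R0.
  by move=> j; rewrite (jac0 _ _ _ hJ) eq_sym Rmult_comm.
rewrite Rplus_0_l => H.
have {}H : norm1 (u t) <= E * (e * (E2 * norm1 k)).
  apply: H => [|s hs l]; first by apply: Rmult_le_pos; nra.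
  split.
    apply: is_derive_sub; first by apply: is_derive_sub; exact: (flow_derive _ _ hPhi).
    apply: (is_derive_rsum _ (fun s j => J s x l j * k j)) => j.
    have hj := jac_derive _ _ _ hJ x s l j.
    have := is_derive_mult (fun s => J s x l j) (fun _ => k j) s _ 0 hj (is_derive_const _ _) Rmult_comm.
    by rewrite /plus /mult /= Rmult_0_r Rplus_0_r.
  have hlip := h2 y x s hs.
  have hlt : norm1 (vsub (Phi s y) (Phi s x)) < d.
    apply: Rle_lt_trans hlip _; have -> : d = E2 * (d / E2) by field; lra.
    exact: Rmult_lt_compat_l.
  have -> : u' s l = \rsum_(j < n) (DF (Phi s x) l j * u s j) +
     (F (Phi s y) l - F (Phi s x) l - \rsum_(j < n) (DF (Phi s x) l j * vsub (Phi s y) (Phi s x) j)).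
    rewrite /u'.
    have -> : \rsum_(j < n) (\rsum_(l0 < n) (DF (Phi s x) l l0 * J s x l0 j) * k j) =
       \rsum_(j < n) (DF (Phi s x) l j * vsub (Phi s y) (Phi s x) j) - \rsum_(j < n) (DF (Phi s x) l j * u s j).
      rewrite -rsum_minus.
      rewrite (rsum_ext _ _ (fun j => \rsum_(l0 < n) (DF (Phi s x) l l0 * (J s x l0 j * k j)))).
        rewrite exchange_big; apply: rsum_ext => l0; rewrite rsum_scal /u /vsub.
        set Z := \rsum_(j < n) _; ring.
      by move=> j; rewrite Rmult_comm -rsum_scal; apply: rsum_ext => l0; ring.
    ring.
  apply: Rle_trans (Rabs_triang _ _) _; apply: Rplus_le_compat.
    by apply: rsum_mul_le => j; apply: (rf_bound' _ _ _ hF).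
  apply: Rle_trans (h3 _ _ hlt l) _.
  by apply: Rmult_le_compat_l; [lra|exact: hlip].
apply: Rle_trans (abs_le_norm1 n (u t) i) (Rle_trans _ _ _ H _).
by right; rewrite /e; field; split; lra.
Qed.

End RegularField.

(** * Compactness of boxes *)

(** At the supremum [s] of the good points, the window around [s] contains a good point; goodness
    then spreads past [s], a contradiction unless [s = b], in which case it reaches [b]. *)
Lemma interval_induction (c : R -> Prop) a b : a <= b -> c a ->
  (forall s, a <= s <= b -> exists d, d > 0 /\
     forall t t', c t -> s - d < t -> t' < s + d -> t' <= b -> c t') -> c b.
Proof.
move=> hab ca hc.
have [||s [hs1 hs2]] := completeness (fun t => a <= t <= b /\ c t).
- by exists b => t [[]].
- by exists a; split=> //; lra.
have hsa : a <= s by apply: hs1; split=> //; lra.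
have hsb : s <= b by apply: hs2 => t [[]].
have [d [hd h]] := hc s (conj hsa hsb).
have [t [[ht ct] hst]] : exists t, (a <= t <= b /\ c t) /\ s - d < t.
  apply: NNPP => hn; have : s <= s - d; last lra.
  apply: hs2 => t ht; apply: Rnot_lt_le => h'; apply: hn; by exists t.
case: (Rlt_dec s b) => hsb'; last first.
  by apply: (h t) => //; lra.
have cm : c (Rmin b (s + d / 2)).
  apply: (h t) => //; last exact: Rmin_l.
  by apply: Rle_lt_trans (Rmin_r _ _) _; lra.
have : Rmin b (s + d / 2) <= s.
  by apply: hs1; split=> //; split; [apply: Rmin_glb; lra|exact: Rmin_l].
by rewrite /Rmin; case: Rle_dec; lra.
Qed.

Definition box {n} (p : vec n) (r : R) (y : vec n) : Prop :=
  forall i, Rabs (y i - p i) <= r.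

(* Compactness as an induction principle on sets; the coordinates are made
   to range over their whole interval one after the other. *)
Lemma box_induction n (p : vec n) r (Q : (vec n -> Prop) -> Prop) : 0 <= r ->
  (forall S S' : vec n -> Prop, (forall y, S' y -> S y) -> Q S -> Q S') ->
  (forall S S' : vec n -> Prop, Q S -> Q S' -> Q (fun y => S y \/ S' y)) ->
  (forall x, exists d, d > 0 /\ Q (fun y => norm1 (vsub y x) < d)) ->
  Q (box p r).
Proof.
move=> hr hmono hunion hloc.
(* The first [m] coordinates fill their interval while the others stay within [d] of [x]: [m = 0] is
   a neighbourhood of [x], and [m = n] is the whole box. *)
pose slab m (x : vec n) d (y : vec n) := forall i : 'I_n,
  if leq i.+1 m then Rabs (y i - p i) <= r else Rabs (y i - x i) < d.
have hslab m : leq m n -> forall x, exists d, d > 0 /\ Q (slab m x d).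
  elim: m => [_ x|m IH hm x].
    have [d [hd h]] := hloc x; have hn := pos_INR n.
    exists (d / (INR n + 1)); split; first by apply: Rdiv_lt_0_compat; lra.
    apply: hmono h => y hy; apply: Rle_lt_trans (norm1_le_const _ _ (d / (INR n + 1)) _) _.
      by move=> i; left; apply: (hy i).
    have -> : INR n * (d / (INR n + 1)) = d - d / (INR n + 1) by field; lra.
    have : 0 < d / (INR n + 1) by apply: Rdiv_lt_0_compat; lra.
    lra.
  pose i0 := Ordinal hm; have {}IH := IH (ltnW hm).
  (* A slab whose coordinate [i0] is swept only up to [t]. Interval induction moves [t] to the right
     end, adding at each stage a slab centred at [upd s] and shrinking [d]. *)
  pose part t d (y : vec n) := p i0 - r <= y i0 <= t /\ forall i : 'I_n, i != i0 ->
    if leq i.+1 m then Rabs (y i - p i) <= r else Rabs (y i - x i) < d.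
  pose upd t : vec n := fun i => if i == i0 then t else x i.
  have [|||d [hd h]] := interval_induction (fun t => exists d, d > 0 /\ Q (part t d)) (p i0 - r) (p i0 + r).
  - lra.
  - have [d [hd h]] := IH (upd (p i0 - r)); exists d; split=> //.
    apply: hmono h => y [hy1 hy2] i; case: (eqVneq i i0) => [->|hi]; last first.
      by have := hy2 i hi; rewrite /upd (negbTE hi).
    rewrite /= ltnn /upd eqxx; have -> : y i0 = p i0 - r by lra.
    by rewrite Rminus_diag Rabs_R0.
  - move=> s hs; have [d [hd h]] := IH (upd s); exists d; split=> // t t' [d1 [hd1 h1]] ht ht' _.
    exists (Rmin d d1); split; first by apply: Rmin_pos.
    apply: hmono (hunion _ _ h h1) => y [hy1 hy2].
    have hy i : i != i0 -> if leq i.+1 m then Rabs (y i - p i) <= r else Rabs (y i - x i) < d /\ Rabs (y i - x i) < d1.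
      move=> hi; have := hy2 i hi; case: ifP => // _ h'.
      by split; apply: Rlt_le_trans h' _; [exact: Rmin_l|exact: Rmin_r].
    case: (Rle_dec (y i0) t) => hyt; [right|left].
      by split=> [|i hi]; [lra|have := hy i hi; case: ifP => // _ []].
    move=> i; case: (eqVneq i i0) => [->|hi].
      by rewrite /= ltnn /upd eqxx; apply: Rabs_def1; lra.
    by have := hy i hi; rewrite /upd (negbTE hi); case: ifP => // _ [].
  exists d; split=> //; apply: hmono h => y hy; split.
    by have := hy i0; rewrite /= ltnSn => /Rabs_le_between'; lra.
  move=> i hi; have := hy i; rewrite ltnS leq_eqVlt.
  by have -> : (nat_of_ord i == m) = false by exact: (negbTE hi).
have [d [_ h]] := hslab n (leqnn n) p.
by apply: hmono h => y hy i; rewrite ltn_ord.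
Qed.

Lemma heine n m k (D : vec n -> mat m k) (p : vec n) r eps : 0 <= r -> eps > 0 ->
  (forall x eps, eps > 0 -> exists delta, delta > 0 /\ forall y, norm1 (vsub y x) < delta ->
     forall i j, Rabs (D y i j - D x i j) < eps) ->
  exists delta, delta > 0 /\ forall x y, box p r x -> norm1 (vsub y x) < delta ->
     forall i j, Rabs (D y i j - D x i j) < eps.
Proof.
move=> hr he hD.
apply: (box_induction n p r (fun S => exists delta, delta > 0 /\ forall x y, S x ->
  norm1 (vsub y x) < delta -> forall i j, Rabs (D y i j - D x i j) < eps)) => //.
- by move=> S S' hSS [d [hd h]]; exists d; split=> // x y hx; apply: h; apply: hSS.
- move=> S S' [d [hd h]] [d' [hd' h']]; exists (Rmin d d'); split; first exact: Rmin_pos.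
  move=> x y [hx|hx] hxy.
    by apply: h => //; apply: Rlt_le_trans hxy (Rmin_l _ _).
  by apply: h' => //; apply: Rlt_le_trans hxy (Rmin_r _ _).
- move=> x; have [|d [hd h]] := hD x (eps / 2); first lra.
  exists (d / 2); split; first lra.
  exists (d / 2); split; first lra.
  move=> z y hz hy i j.
  have h1 := h z ltac:(lra) i j.
  have h2 : norm1 (vsub y x) < d by have := norm1_triangle n y z x; lra.
  have := h y h2 i j => h3.
  have -> : D y i j - D z i j = (D y i j - D x i j) + - (D z i j - D x i j) by ring.
  apply: Rle_lt_trans (Rabs_triang _ _) _; rewrite Rabs_Ropp; lra.
Qed.

Lemma bounded_on_box n m k (D : vec n -> mat m k) (p : vec n) r : 0 <= r ->
  (forall x eps, eps > 0 -> exists delta, delta > 0 /\ forall y, norm1 (vsub y x) < delta ->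
     forall i j, Rabs (D y i j - D x i j) < eps) ->
  exists K, 0 <= K /\ forall x, box p r x -> forall i j, Rabs (D x i j) <= K.
Proof.
move=> hr hD.
apply: (box_induction n p r (fun S => exists K, 0 <= K /\ forall x, S x -> forall i j, Rabs (D x i j) <= K)) => //.
- by move=> S S' hSS [K [hK h]]; exists K; split=> // x hx; apply: h; apply: hSS.
- move=> S S' [K [hK h]] [K' [hK' h']]; exists (Rmax K K'); split.
    by apply: Rle_trans hK (Rmax_l _ _).
  move=> x [hx|hx] i j.
    exact: Rle_trans (h x hx i j) (Rmax_l _ _).
  exact: Rle_trans (h' x hx i j) (Rmax_r _ _).
- move=> x; have [|d [hd h]] := hD x 1; first lra.
  exists d; split=> //.
  pose N := \rsum_(i < m) (\rsum_(j < k) Rabs (D x i j)).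
  have hN i j : Rabs (D x i j) <= N.
    apply: (Rle_trans _ (\rsum_(j < k) Rabs (D x i j))).
      by apply: (rsum_term _ (fun j => Rabs (D x i j))) => l; apply: Rabs_pos.
    apply: (rsum_term _ (fun i => \rsum_(j < k) Rabs (D x i j))) => l.
    by apply: rsum_ge0 => j'; apply: Rabs_pos.
  exists (1 + N); split.
    have : 0 <= N by apply: rsum_ge0 => i; apply: rsum_ge0 => j; apply: Rabs_pos.
    lra.
  move=> y hy i j; have := h y hy i j; have := hN i j.
  have := Rabs_triang (D y i j - D x i j) (D x i j).
  have -> : D y i j - D x i j + D x i j = D y i j by ring.
  lra.
Qed.

(** * Truncation of the vector field *)

Definition pos_part (s : R) : R := Rmax 0 s.

Lemma pos_partP s : (0 <= s /\ pos_part s = s) \/ (s < 0 /\ pos_part s = 0).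
Proof. by rewrite /pos_part /Rmax; case: Rle_dec => h; [left|right]; split=> //; lra. Qed.

Lemma pos_part_lip s t : Rabs (pos_part s - pos_part t) <= Rabs (s - t).
Proof.
have h1 := Rle_abs (s - t); have := Rle_abs (- (s - t)); rewrite Rabs_Ropp => h2.
by apply: Rabs_le; case: (pos_partP s) => -[? ->]; case: (pos_partP t) => -[? ->]; lra.
Qed.

(** In every combination of signs the first-order remainder is at most [(s - t) ^ 2]. Squaring makes
    the positive part C^1, which is all the smoothness that [clamp] and [bump] require. *)
Lemma is_derive_pos_part_sqr (t : R) :
  is_derive (fun s => pos_part s * pos_part s) t (2 * pos_part t).
Proof.
apply/is_deriveP => eps he; exists eps; split=> // s hs.
apply: (Rle_trans _ (Rabs (s - t) * Rabs (s - t))); last first.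
  by apply: Rmult_le_compat_r; [exact: Rabs_pos|lra].
rewrite -Rabs_mult (Rabs_pos_eq ((s - t) * (s - t))); last exact: Rle_0_sqr.
have h := Rle_0_sqr (s - t); rewrite /Rsqr in h.
by apply: Rabs_le; case: (pos_partP s) => -[? ->]; case: (pos_partP t) => -[? ->]; nra.
Qed.

(** The odd primitive of a trapezoid ([dclamp]) that is [1] on [[-1, 1]], [0] where [|s| >= 2] and
    linear in between: the identity near [0], constant equal to [3/2] or [-3/2] far away. *)
Definition clamp s := s - (pos_part (s - 1) * pos_part (s - 1) - pos_part (s - 2) * pos_part (s - 2)) / 2
  + (pos_part (- s - 1) * pos_part (- s - 1) - pos_part (- s - 2) * pos_part (- s - 2)) / 2.

Definition dclamp s := 1 - (pos_part (s - 1) - pos_part (s - 2))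
  - (pos_part (- s - 1) - pos_part (- s - 2)).

Lemma is_derive_clamp s : is_derive clamp s (dclamp s).
Proof.
pose sq s := pos_part s * pos_part s.
have h t : is_derive sq t (2 * pos_part t) := is_derive_pos_part_sqr t.
have hd t : ex_derive sq t by eexists; apply: h.
have hD t : Derive (fun x => sq x) t = 2 * pos_part t by apply: is_derive_unique.
apply: (is_derive_ext (fun s => s - (sq (s - 1) - sq (s - 2)) / 2 + (sq (- s - 1) - sq (- s - 2)) / 2)) => //.
auto_derive; first by repeat split; apply: hd.
by rewrite !hD /dclamp /Rminus; field.
Qed.

Lemma clamp_id s : Rabs s <= 1 -> clamp s = s.
Proof.
move=> /Rabs_le_between hs; rewrite /clamp /pos_part !(Rmax_left 0); lra.
Qed.

Lemma clamp_le2 s : Rabs (clamp s) <= 2.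
Proof.
apply: Rabs_le; rewrite /clamp.
by case: (pos_partP (s - 1)) => -[? ->]; case: (pos_partP (s - 2)) => -[? ->];
  case: (pos_partP (- s - 1)) => -[? ->]; case: (pos_partP (- s - 2)) => -[? ->]; nra.
Qed.

Lemma dclamp_le1 s : Rabs (dclamp s) <= 1.
Proof.
apply: Rabs_le; rewrite /dclamp.
by case: (pos_partP (s - 1)) => -[? ->]; case: (pos_partP (s - 2)) => -[? ->];
  case: (pos_partP (- s - 1)) => -[? ->]; case: (pos_partP (- s - 2)) => -[? ->]; lra.
Qed.

Lemma dclamp_lip s t : Rabs (dclamp s - dclamp t) <= 4 * Rabs (s - t).
Proof.
have h1 := pos_part_lip (s - 1) (t - 1); have h2 := pos_part_lip (s - 2) (t - 2).
have h3 := pos_part_lip (- s - 1) (- t - 1); have h4 := pos_part_lip (- s - 2) (- t - 2).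
move: h1 h2 h3 h4; rewrite /dclamp.
have -> : s - 1 - (t - 1) = s - t by ring.
have -> : s - 2 - (t - 2) = s - t by ring.
have -> : - s - 1 - (- t - 1) = - (s - t) by ring.
have -> : - s - 2 - (- t - 2) = - (s - t) by ring.
rewrite Rabs_Ropp => /Rabs_le_between h1 /Rabs_le_between h2 /Rabs_le_between h3 /Rabs_le_between h4.
apply: Rabs_le; lra.
Qed.

Lemma clamp_lip s t : Rabs (clamp s - clamp t) <= Rabs (s - t).
Proof.
have [x _|x _|c [_ ->]] := MVT_gen clamp t s dclamp.
- exact: is_derive_clamp.
- by apply: derivable_continuous_pt; exists (dclamp x); apply/is_derive_Reals/is_derive_clamp.
rewrite Rabs_mult; have := dclamp_le1 c; have := Rabs_pos (s - t); nra.
Qed.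

Definition retract {n} (p x : vec n) : vec n := fun i => p i + clamp (x i - p i).

Lemma retract_box n (p x : vec n) : box p 2 (retract p x).
Proof.
move=> i; rewrite /retract; have -> : p i + clamp (x i - p i) - p i = clamp (x i - p i) by ring.
exact: clamp_le2.
Qed.

Lemma retract_id n (p x : vec n) : box p 1 x -> retract p x = x.
Proof.
move=> h; apply: functional_extensionality => i; rewrite /retract clamp_id //; ring.
Qed.

(** The field is precomposed with [retract p], which fixes the unit box and sends the whole space
    into a compact one. Compactness thus turns the local bounds and the continuity of [Df] into
    global, uniform ones. *)
Lemma truncated_field n (f : vec n -> vec n) p : C1_on (fun _ => True) f -> equilibrium f p ->
  exists F DF B, regular_field F DF B /\ forall x, box p 1 x -> F x = f x.
Proof.
move=> [Df [hDf hc]] hp.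
have hc' x eps : eps > 0 -> exists delta, delta > 0 /\ forall y, norm1 (vsub y x) < delta ->
    forall i j, Rabs (Df y i j - Df x i j) < eps.
  move=> he; have [d [hd h]] := hc x I eps he; exists d; split=> // y hy.
  by apply: h => //; apply: Rle_lt_trans hy; apply: vnorm_le_norm1.
have h02 : 0 <= 2 by lra.
have [K [hK hKb]] := bounded_on_box n n n Df p 2 h02 hc'.
have hfd x i : curve_diff_at (fun y => f y i) x (Df x i).
  exact: curve_diff_of_derivative (hDf x I).
have hn := pos_INR n.
have hfb x i : box p 2 x -> Rabs (f x i) <= K * (INR n * 2).
  move=> hx; have [s _|s [hs h]] := line_MVT n (fun y => f y i) (fun y => Df y i) p (vsub x p).
    exact: hfd.
  rewrite vadd_vsub hp Rminus_0_r in h; rewrite h.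
  apply: (Rle_trans _ (K * norm1 (vsub x p))); last first.
    by apply: Rmult_le_compat_l => //; apply: norm1_le_const.
  apply: rsum_mul_le => j; apply: hKb => l; rewrite /line /vsub.
  have -> : p l + s * (x l - p l) - p l = s * (x l - p l) by ring.
  rewrite Rabs_mult (Rabs_pos_eq s); last lra.
  by have := hx l; have := Rabs_pos (x l - p l); nra.
(* The bound [K * (INR n * 2 + 1)] dominates both [K], for the derivative, and [K * (INR n * 2)],
   for the field itself, obtained by the mean value theorem from [f p = 0]. *)
exists (fun x => f (retract p x)), (fun x i j => Df (retract p x) i j * dclamp (x j - p j)), (K * (INR n * 2 + 1)).
have hKn : K <= K * (INR n * 2 + 1) by nra.
split; last by move=> x hx; rewrite retract_id.
split.
- by nra.
- move=> x i c v t hct hv.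
  rewrite (rsum_ext _ _ (fun j => Df (retract p x) i j * (dclamp (x j - p j) * v j))); last by move=> j; ring.
  apply: (hfd (retract p x) i (fun s => retract p (c s)) _ t) => [|j]; first by rewrite hct.
  rewrite -hct -[dclamp _ * _]Rplus_0_l.
  apply: (is_derive_plus (K := R_AbsRing) (V := R_NormedModule) (fun _ => p j) (fun s => clamp (c s j - p j))).
    exact: is_derive_const.
  rewrite Rmult_comm; apply: (is_derive_comp clamp (fun s => c s j - p j)).
    exact: is_derive_clamp.
  rewrite -[v j]Rminus_0_r; apply: (is_derive_sub (fun s => c s j) (fun _ => p j)) => //.
  exact: is_derive_const.
- move=> x i; apply: Rle_trans (hfb _ _ (retract_box n p x)) _; nra.
- move=> x i j; rewrite Rabs_mult.
  have := hKb _ (retract_box n p x) i j; have := dclamp_le1 (x j - p j).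
  have := Rabs_pos (dclamp (x j - p j)); have := Rabs_pos (Df (retract p x) i j); nra.
move=> eps he; have he2 : eps / 2 > 0 by lra.
have [d [hd h]] := heine n n n Df p 2 (eps / 2) h02 he2 hc'.
(* The variation of the factor [dclamp], which is 4-Lipschitz, costs at most
   [K * (4 * d2) <= eps / 2]; the variation of [Df] takes the other half. *)
pose d2 := eps / (8 * (K + 1)).
have hd2 : d2 > 0 by apply: Rdiv_lt_0_compat; lra.
exists (Rmin d d2); split=> [|x y hxy i j]; first exact: Rmin_pos.
have hr : norm1 (vsub (retract p y) (retract p x)) < d.
  apply: Rle_lt_trans (Rlt_le_trans _ _ _ hxy (Rmin_l _ _)).
  apply: rsum_le => l; rewrite /vsub /retract.
  have -> : p l + clamp (y l - p l) - (p l + clamp (x l - p l)) = clamp (y l - p l) - clamp (x l - p l) by ring.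
  apply: Rle_trans (clamp_lip _ _) _; right; congr Rabs; ring.
have h1 := h _ _ (retract_box n p x) hr i j.
have h2 := dclamp_lip (y j - p j) (x j - p j).
have h3 : Rabs (y j - p j - (x j - p j)) < d2.
  apply: Rle_lt_trans (Rlt_le_trans _ _ _ hxy (Rmin_r _ _)).
  have -> : y j - p j - (x j - p j) = vsub y x j by rewrite /vsub; ring.
  exact: abs_le_norm1.
have h4 := hKb _ (retract_box n p x) i j; have h5 := dclamp_le1 (y j - p j).
have -> : Df (retract p y) i j * dclamp (y j - p j) - Df (retract p x) i j * dclamp (x j - p j) =
  (Df (retract p y) i j - Df (retract p x) i j) * dclamp (y j - p j) +
  Df (retract p x) i j * (dclamp (y j - p j) - dclamp (x j - p j)) by ring.
apply: Rle_lt_trans (Rabs_triang _ _) _; rewrite !Rabs_mult.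
have h6 : Rabs (dclamp (y j - p j) - dclamp (x j - p j)) <= 4 * d2 by lra.
have h7 : (K + 1) * (4 * d2) = eps / 2 by rewrite /d2; field; lra.
have h8 := Rabs_pos (Df (retract p x) i j); have h9 := Rabs_pos (dclamp (y j - p j)).
have h10 := Rabs_pos (Df (retract p y) i j - Df (retract p x) i j).
have h11 := Rabs_pos (dclamp (y j - p j) - dclamp (x j - p j)).
have h12 := Rmult_le_compat _ _ _ _ h8 h11 h4 h6.
have h13 := Rmult_le_compat_l _ _ _ h10 h5.
lra.
Qed.

(** * Integrals depending on a parameter *)

Lemma ex_RInt_cont (f : R -> R) a b : (forall s, continuous f s) -> ex_RInt f a b.
Proof. by move=> h; apply: ex_RInt_continuous => s _. Qed.

Lemma is_RInt_rsum n (f : R -> 'I_n -> R) (l : 'I_n -> R) a b :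
  (forall i, is_RInt (fun s => f s i) a b (l i)) ->
  is_RInt (fun s => \rsum_(i < n) f s i) a b (\rsum_(i < n) l i).
Proof.
elim: n f l => [|n IH] f l h.
  rewrite big_ord0; apply: (is_RInt_ext (fun _ => 0)) => [s _|]; first by rewrite big_ord0.
  have := is_RInt_const (V := R_NormedModule) a b 0.
  by rewrite /scal /= /mult /= Rmult_0_r.
rewrite big_ord_recl.
apply: (is_RInt_ext (fun s => f s ord0 + \rsum_(i < n) f s (lift ord0 i))) => [s _|].
  by rewrite big_ord_recl.
apply: (is_RInt_plus (V := R_NormedModule)); first exact: h.
by apply: (IH (fun s i => f s (lift ord0 i))).
Qed.

Lemma RInt_sub_le (f g : R -> R) a b e : a <= b -> (forall s, continuous f s) ->
  (forall s, continuous g s) -> (forall s, a <= s <= b -> Rabs (f s - g s) <= e) ->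
  Rabs (RInt f a b - RInt g a b) <= (b - a) * e.
Proof.
move=> hab hf hg h.
have -> : RInt f a b - RInt g a b = RInt (fun s => f s - g s) a b.
  by symmetry; apply: (RInt_minus (V := R_CompleteNormedModule)); apply: ex_RInt_cont.
apply: abs_RInt_le_const => //; apply: ex_RInt_cont => s.
exact: (continuous_minus (V := R_NormedModule)).
Qed.

(** Differentiation under the integral: for each [s] the mean value theorem reduces the remainder to
    a variation of the gradient, small uniformly in [s] on [[a, b]]. *)
Lemma RInt_curve_diff n (H : R -> vec n -> R) (DH : R -> vec n -> vec n) a b x : a <= b ->
  (forall s y, curve_diff_at (H s) y (DH s y)) ->
  (forall s y, continuous (fun s => H s y) s) ->
  (forall s y j, continuous (fun s => DH s y j) s) ->
  (forall eps, eps > 0 -> exists delta, delta > 0 /\ forall y, norm1 (vsub y x) < delta ->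
     forall s, a <= s <= b -> forall j, Rabs (DH s y j - DH s x j) < eps) ->
  curve_diff_at (fun y => RInt (fun s => H s y) a b) x (fun j => RInt (fun s => DH s x j) a b).
Proof.
move=> hab hH hHc hDc hu; apply: curve_diff_of_little_o => eps he.
have he' : eps / (b - a + 1) > 0 by apply: Rdiv_lt_0_compat; lra.
have [d [hd h]] := hu _ he'; exists d; split=> // z hz.
set k := vsub z x in hz *; have hk := norm1_ge0 n k.
have hsum : is_RInt (fun s => \rsum_(j < n) (DH s x j * k j)) a b
    (\rsum_(j < n) (RInt (fun s => DH s x j) a b * k j)).
  apply: (is_RInt_rsum _ (fun s j => DH s x j * k j)) => j.
  rewrite Rmult_comm; apply: (is_RInt_ext (fun s => scal (k j) (DH s x j))) => [s _|].
    exact: Rmult_comm.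
  apply: (is_RInt_scal (V := R_NormedModule)); apply: RInt_correct.
  by apply: ex_RInt_cont.
have hsumc s : continuous (fun s => \rsum_(j < n) (DH s x j * k j)) s.
  apply: (continuous_rsum _ _ (fun s j => DH s x j * k j)) => j.
  by apply: (continuous_mult (fun s => DH s x j)) => //; apply: continuous_const.
rewrite -(is_RInt_unique _ _ _ _ hsum).
have -> : RInt (fun s => H s z) a b - RInt (fun s => H s x) a b =
    RInt (fun s => H s z - H s x) a b.
  by symmetry; apply: (RInt_minus (V := R_CompleteNormedModule)); apply: ex_RInt_cont.
apply: (Rle_trans _ ((b - a) * (eps / (b - a + 1) * norm1 k))); last first.
  have h1 : (b - a) * (eps / (b - a + 1)) = eps - eps / (b - a + 1) by field; lra.
  by rewrite -Rmult_assoc h1; nra.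
apply: RInt_sub_le => // [s|s hs].
  exact: (continuous_minus (V := R_NormedModule) (fun s => H s z)).
have [r hr|r [hr]] := line_MVT n (H s) (DH s) x k; first exact: hH.
rewrite /k vadd_vsub -/k => ->; rewrite -rsum_minus.
rewrite (rsum_ext _ _ (fun j => (DH s (line x k r) j - DH s x j) * k j)); last by move=> j; ring.
apply: rsum_mul_le => j; left; apply: h => //.
by rewrite norm1_line Rabs_pos_eq; [nra|lra].
Qed.

Lemma RInt_support (f : R -> R) M a b : 0 <= M -> (forall s, continuous f s) ->
  (forall s, M <= Rabs s -> f s = 0) -> a <= - M -> M <= b -> RInt f a b = RInt f (- M) M.
Proof.
move=> hM hf h0 ha hb.
have hz u v : (forall s, Rmin u v < s < Rmax u v -> f s = 0) -> RInt f u v = 0.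
  move=> h; rewrite (RInt_ext _ (fun _ => 0)) // RInt_const.
  by rewrite /scal /= /mult /= Rmult_0_r.
rewrite -(RInt_Chasles f a (- M) b); try exact: ex_RInt_cont.
rewrite -(RInt_Chasles f (- M) M b); try exact: ex_RInt_cont.
rewrite (hz a (- M)) => [|s]; last first.
  by rewrite Rmin_left ?Rmax_right // => hs; apply: h0; rewrite Rabs_left; lra.
rewrite (hz M b) => [|s]; last first.
  by rewrite Rmin_left ?Rmax_right // => hs; apply: h0; rewrite Rabs_pos_eq; lra.
by rewrite /plus /= Rplus_0_l Rplus_0_r.
Qed.

Lemma RInt_pos (f : R -> R) a b s0 : (forall s, continuous f s) -> (forall s, 0 <= f s) ->
  a < s0 < b -> 0 < f s0 -> 0 < RInt f a b.
Proof.
move=> hf h0 hs hp; have [d [hd h]] := proj1 (continuousP f s0) (hf s0) (f s0) hp.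
pose c := Rmax a (s0 - d / 2); pose e := Rmin b (s0 + d / 2).
have hc : a <= c /\ s0 - d / 2 <= c /\ c < s0.
  by split; [exact: Rmax_l|split; [exact: Rmax_r|apply: Rmax_lub_lt; lra]].
have hee : e <= b /\ e <= s0 + d / 2 /\ s0 < e.
  by split; [exact: Rmin_l|split; [exact: Rmin_r|apply: Rmin_glb_lt; lra]].
rewrite -(RInt_Chasles f a c b); try exact: ex_RInt_cont.
rewrite -(RInt_Chasles f c e b); try exact: ex_RInt_cont.
have h1 : 0 <= RInt f a c by apply: RInt_ge_0; [lra|exact: ex_RInt_cont|move=> *].
have h2 : 0 <= RInt f e b by apply: RInt_ge_0; [lra|exact: ex_RInt_cont|move=> *].
have h3 : 0 < RInt f c e.
  apply: RInt_gt_0 => // [|s hs']; first lra.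
  have hx : Rabs (f s - f s0) < f s0 by apply: h; apply: Rabs_def1; lra.
  by have [] := Rabs_def2 _ _ hx; lra.
rewrite /plus /=; lra.
Qed.

(** Meant for the improper integral below, which agrees with an integral over a fixed interval only
    near a given point. *)
Lemma curve_diff_local n (F G : vec n -> R) y g d : d > 0 ->
  (forall z, norm1 (vsub z y) < d -> F z = G z) ->
  curve_diff_at F y g -> curve_diff_at G y g.
Proof.
move=> hd hFG hF c v t hc hv.
apply: (is_derive_ext_loc (fun s => F (c s))); last exact: hF.
have hn : continuous (fun s => norm1 (vsub (c s) y)) t.
  apply: (continuous_rsum _ _ (fun s i => Rabs (vsub (c s) y i))) => i.
  apply: (continuous_comp (fun s => vsub (c s) y i) Rabs); last exact: continuous_Rabs.
  apply: (continuous_minus (V := R_NormedModule) (fun s => c s i) (fun _ => y i)).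
    by apply: ex_derive_continuous; eexists; apply: hv.
  exact: continuous_const.
have [e [he h]] := proj1 (continuousP _ _) hn d hd.
exists (mkposreal e he) => s hs; apply: hFG; have := h s hs.
rewrite hc norm1_vsub0 Rminus_0_r Rabs_pos_eq //; exact: norm1_ge0.
Qed.

(* The alias makes Coquelicot's continuity lemmas available on vectors. *)
Definition vec_uniform (n : nat) : UniformSpace := fct_UniformSpace 'I_n R_UniformSpace.

Lemma vcontinuous n (h : vec_uniform n -> R) x : continuous h x ->
  forall eps, eps > 0 -> exists delta, delta > 0 /\ forall y : vec n,
    norm1 (vsub y x) < delta -> Rabs (h y - h x) < eps.
Proof.
move=> hc eps he; have [d hd] := proj1 (filterlim_locally h (h x)) hc (mkposreal eps he).
exists d; split=> [|y hy]; first exact: cond_pos.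
apply: hd => i; apply: Rle_lt_trans hy; exact: (abs_le_norm1 n (vsub y x)).
Qed.

Lemma continuous_coord n i (x : vec_uniform n) : continuous (fun y : vec_uniform n => y i) x.
Proof. by apply/filterlim_locally => eps; exists eps => y hy; apply: hy. Qed.

Lemma continuous_normsq n (p : vec n) x : continuous (fun y : vec_uniform n => normsq (vsub y p)) x.
Proof.
have h i : continuous (fun y : vec_uniform n => vsub y p i) x.
  apply: (continuous_minus (V := R_NormedModule) (fun y : vec_uniform n => y i) (fun _ => p i)).
    exact: continuous_coord.
  exact: continuous_const.
apply: (continuous_rsum _ _ (fun (y : vec_uniform n) i => vsub y p i * vsub y p i)) => i.
exact: (continuous_mult (fun y : vec_uniform n => vsub y p i)).
Qed.

Lemma normsq_vcont n (p x : vec n) eps : eps > 0 -> exists delta, delta > 0 /\ forall y : vec n,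
  norm1 (vsub y x) < delta -> Rabs (normsq (vsub y p) - normsq (vsub x p)) < eps.
Proof. exact: (vcontinuous n _ x (continuous_normsq n p x)). Qed.

(** * The Lyapunov function *)

(* To be composed with the squared distance to [p]: the annulus is given by
   squared radii. *)
Definition bump r1 r2 s := pos_part ((s - r1) * (r2 - s)) * pos_part ((s - r1) * (r2 - s)).
Definition dbump r1 r2 s := 2 * pos_part ((s - r1) * (r2 - s)) * (r1 + r2 - 2 * s).

Lemma is_derive_bump r1 r2 (s : R) : is_derive (bump r1 r2) s (dbump r1 r2 s).
Proof.
rewrite /dbump Rmult_comm.
apply: (is_derive_comp (fun s => pos_part s * pos_part s) (fun s => (s - r1) * (r2 - s))).
  exact: is_derive_pos_part_sqr.
by auto_derive => //; ring.
Qed.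

Lemma continuous_pos_part (s : R) : continuous pos_part s.
Proof.
apply/continuousP => eps he; exists eps; split=> // t ht.
exact: Rle_lt_trans (pos_part_lip _ _) ht.
Qed.

Lemma continuous_dbump r1 r2 (s : R) : continuous (dbump r1 r2) s.
Proof.
have h1 : continuous (fun s => (s - r1) * (r2 - s)) s.
  by apply: ex_derive_continuous; auto_derive.
have h2 : continuous (fun s => r1 + r2 - 2 * s) s.
  by apply: ex_derive_continuous; auto_derive.
apply: (continuous_mult (fun s => 2 * pos_part ((s - r1) * (r2 - s))) (fun s => r1 + r2 - 2 * s)) => //.
apply: (continuous_mult (fun _ => 2)); first exact: continuous_const.
apply: (continuous_comp (fun s => (s - r1) * (r2 - s)) pos_part) => //.
exact: continuous_pos_part.
Qed.

Lemma bump_ge0 r1 r2 s : 0 <= bump r1 r2 s.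
Proof. exact: Rle_0_sqr. Qed.

Lemma bump_gt0 r1 r2 s : r1 < s < r2 -> 0 < bump r1 r2 s.
Proof.
move=> hs; have h : 0 < (s - r1) * (r2 - s) by apply: Rmult_lt_0_compat; lra.
rewrite /bump; case: (pos_partP ((s - r1) * (r2 - s))) => -[h' ->]; nra.
Qed.

Lemma bump_out r1 r2 s : r1 <= r2 -> s <= r1 \/ r2 <= s -> bump r1 r2 s = 0 /\ dbump r1 r2 s = 0.
Proof.
move=> hr hs; have h : pos_part ((s - r1) * (r2 - s)) = 0.
  by case: (pos_partP ((s - r1) * (r2 - s))) => -[h' ->] //; case: hs => hs; nra.
by rewrite /bump /dbump h; split; ring.
Qed.

(** By the inequality of arithmetic and geometric means, [(s - r1) * (r2 - s) <= (r2 - r1) ^ 2 / 4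
    <= 1]. *)
Lemma bump_le1 r1 r2 s : 0 <= r1 -> r1 <= r2 -> r2 <= 1 -> bump r1 r2 s <= 1.
Proof.
move=> h1 h2 h3; have h : pos_part ((s - r1) * (r2 - s)) <= 1.
  case: (pos_partP ((s - r1) * (r2 - s))) => -[h' ->]; last lra.
  have := Rle_0_sqr (s - r1 - (r2 - s)); rewrite /Rsqr; nra.
have h0 : 0 <= pos_part ((s - r1) * (r2 - s)).
  by case: (pos_partP ((s - r1) * (r2 - s))) => -[h' ->]; lra.
rewrite /bump; nra.
Qed.

(** The exponent of [flow_expansion], that is, the [C] of the overview. The [+ 1] keeps it positive
    in all cases, hence also [a]. *)
Definition expansion_rate (n : nat) (B : R) : R := 2 * B * INR n + 1.

Lemma expansion_rate_gt0 n (F : vec n -> vec n) DF B :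
  regular_field F DF B -> 0 < expansion_rate n B.
Proof.
move=> hF; rewrite /expansion_rate.
by have := pos_INR n; have := rf_ge0 _ _ _ hF; nra.
Qed.

Section Lyapunov.
Context {n : nat} {F : vec n -> vec n} {DF : vec n -> mat n n} {B : R}
  {Phi : R -> vec n -> vec n} {J : R -> vec n -> mat n n} {p : vec n}.
Hypothesis (hF : regular_field F DF B) (hPhi : is_flow F Phi) (hJ : is_jacobian DF Phi J).
Hypothesis (hp : equilibrium F p).

Definition dist2 (x : vec n) : R := normsq (vsub x p).

Lemma dist2_p : dist2 p = 0.
Proof. by apply: big1 => i _; rewrite /vsub; ring. Qed.

Lemma continuous_dist2 x : continuous (dist2 : vec_uniform n -> R) x.
Proof. exact: continuous_normsq. Qed.

Lemma continuous_dist2_flow x t : continuous (fun s => dist2 (Phi s x)) t.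
Proof.
apply: (continuous_comp_vec n dist2 (fun s => Phi s x)) => [i|eps he].
  exact: flow_continuous hPhi _ _ _.
exact: normsq_vcont.
Qed.

(** * Attraction, uniform in the initial point *)

Hypothesis (stable : forall eps, eps > 0 -> exists delta, delta > 0 /\
  forall x, dist2 x < delta -> forall t, 0 <= t -> dist2 (Phi t x) < eps).
Context {eta : R}.
Hypothesis (attractive : forall x, dist2 x < eta ->
  forall eps, eps > 0 -> exists T, 0 <= T /\ dist2 (Phi T x) < eps).

(** Once the orbit of [x] has entered a stability neighbourhood at time [T], so have, at the same
    [T], the orbits of nearby points, and stability keeps them close to [p] ever after. Compactness
    then yields one [T] for the ball; [r <= 1] places that ball in the unit box. *)
Lemma uniformly_attractive r eps : r <= 1 -> r < eta -> eps > 0 -> exists T, 0 <= T /\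
  forall x, dist2 x <= r -> forall t, T <= t -> dist2 (Phi t x) < eps.
Proof.
move=> hr1 hr he.
have [T [hT h]] : exists T, 0 <= T /\ forall x, box p 1 x -> dist2 x <= r ->
    forall t, T <= t -> dist2 (Phi t x) < eps; last first.
  exists T; split=> // x hx; apply: h => // i.
  have := sqr_le_normsq n (vsub x p) i; rewrite -/(dist2 x) /vsub => h1.
  by apply: Rabs_le; nra.
have h01 : 0 <= 1 by lra.
apply: (box_induction n p 1 (fun S => exists T, 0 <= T /\ forall x, S x -> dist2 x <= r ->
    forall t, T <= t -> dist2 (Phi t x) < eps)) => //.
- by move=> S S' hSS [T [hT h]]; exists T; split=> // x hx; apply: h; apply: hSS.
- move=> S S' [T [hT h]] [T' [hT' h']]; exists (Rmax T T'); split.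
    exact: Rle_trans hT (Rmax_l _ _).
  move=> x [hx|hx] hxr t ht.
    by apply: h => //; apply: Rle_trans ht; apply: Rmax_l.
  by apply: h' => //; apply: Rle_trans ht; apply: Rmax_r.
move=> x; case: (Rlt_dec (dist2 x) eta) => hx; last first.
  (* Box points outside the basin need no attraction: their neighbours violate [dist2 y <= r], so
     the claim is vacuous near them. *)
  have [|d [hd h]] := normsq_vcont n p x (eta - r); first lra.
  exists d; split=> //; exists 0; split; first lra.
  move=> y hy hyr; have /Rabs_def2 := h y hy; rewrite -!/(dist2 _); lra.
have [d [hd h]] := stable eps he; have [T [hT hxT]] := attractive x hx d hd.
have [|d1 [hd1 h1]] := normsq_vcont n p (Phi T x) (d - dist2 (Phi T x)); first lra.
have [E [hE h2]] := flow_lipschitz hF hPhi T hT.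
exists (d1 / E); split; first exact: Rdiv_lt_0_compat.
exists T; split=> // y hy _ t ht.
have h3 : norm1 (vsub (Phi T y) (Phi T x)) < d1.
  apply: Rle_lt_trans (h2 _ _ _ _) _; first by rewrite Rabs_pos_eq //; lra.
  have -> : d1 = E * (d1 / E) by field; lra.
  exact: Rmult_lt_compat_l.
have h4 : dist2 (Phi T y) < d by have /Rabs_def2 := h1 _ h3; rewrite -!/(dist2 _); lra.
have -> : t = (t - T) + T by ring.
by rewrite -(flow_group hF hPhi); apply: h => //; lra.
Qed.

(** * The cutoff to the annulus and the weighted integrand *)

Context {r1 r2 : R}.
Hypothesis (hr1 : 0 < r1) (hr12 : r1 < r2) (hr2 : r2 <= 1) (hr2' : r2 < eta).

Local Notation C := (expansion_rate n B).

Definition cutoff (x : vec n) : R := bump r1 r2 (dist2 x).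
Definition dcutoff (x : vec n) : vec n := fun i => dbump r1 r2 (dist2 x) * (2 * vsub x p i).

Lemma cutoff_curve_diff x : curve_diff_at cutoff x (dcutoff x).
Proof.
move=> c v t hc hv.
have -> : \rsum_(j < n) (dcutoff x j * v j) = (\rsum_(j < n) (2 * vsub x p j * v j)) * dbump r1 r2 (dist2 x).
  by rewrite Rmult_comm -rsum_scal; apply: rsum_ext => j; rewrite /dcutoff; ring.
apply: (is_derive_comp (bump r1 r2) (fun s => dist2 (c s))).
  by rewrite hc; apply: is_derive_bump.
apply: (is_derive_rsum _ (fun s j => vsub (c s) p j * vsub (c s) p j)) => j.
rewrite -hc; apply: (is_derive_sqr (fun s => vsub (c s) p j)).
rewrite -[v j]Rminus_0_r; apply: (is_derive_sub (fun s => c s j) (fun _ => p j)) => //.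
exact: is_derive_const.
Qed.

Lemma dcutoff_vcont x eps : eps > 0 -> exists delta, delta > 0 /\ forall y : vec n,
  norm1 (vsub y x) < delta -> forall i, Rabs (dcutoff y i - dcutoff x i) < eps.
Proof.
move=> he.
suff [d [hd h]] : exists d, d > 0 /\ forall i (y : vec n), norm1 (vsub y x) < d ->
    Rabs (dcutoff y i - dcutoff x i) < eps.
  by exists d; split=> // y hy i; apply: h.
apply: finite_delta => [i d d' hd h y hy|i]; first by apply: h; lra.
apply: (vcontinuous n (fun y => dcutoff y i) x) => //.
apply: (continuous_mult (fun y : vec_uniform n => dbump r1 r2 (dist2 y)) (fun y : vec_uniform n => 2 * vsub y p i)).
  apply: (continuous_comp (dist2 : vec_uniform n -> R) (dbump r1 r2)).
    exact: continuous_dist2.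
  exact: continuous_dbump.
apply: (continuous_mult (fun _ => 2) (fun y : vec_uniform n => vsub y p i)).
  exact: continuous_const.
apply: (continuous_minus (V := R_NormedModule) (fun y : vec_uniform n => y i) (fun _ => p i)).
  exact: continuous_coord.
exact: continuous_const.
Qed.

Definition integrand (s : R) (x : vec n) : R := exp (2 * C * s) * cutoff (Phi s x).
Definition dintegrand (s : R) (x : vec n) : vec n :=
  fun j => exp (2 * C * s) * \rsum_(i < n) (dcutoff (Phi s x) i * J s x i j).

Lemma integrand_curve_diff s x : curve_diff_at (integrand s) x (dintegrand s x).
Proof.
move=> c v t hc hv.
have -> : \rsum_(j < n) (dintegrand s x j * v j) =
    exp (2 * C * s) * \rsum_(j < n) (\rsum_(i < n) (dcutoff (Phi s x) i * J s x i j) * v j).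
  by rewrite -rsum_scal; apply: rsum_ext => j; rewrite /dintegrand; ring.
apply: (is_derive_scal (fun r => cutoff (Phi s (c r)))).
apply: (curve_diff_comp n n cutoff (Phi s) x _ (J s x)) => //.
  exact: cutoff_curve_diff.
by move=> i; apply (flow_curve_diff hF hPhi hJ).
Qed.

Lemma continuous_exp_lin (c s : R) : continuous (fun s => exp (c * s)) s.
Proof. by apply: ex_derive_continuous; auto_derive. Qed.

Lemma integrand_continuous x s : continuous (fun s => integrand s x) s.
Proof.
apply: (continuous_mult (fun s => exp (2 * C * s)) (fun s => cutoff (Phi s x))).
  exact: continuous_exp_lin.
apply: ex_derive_continuous; eexists.
apply: (cutoff_curve_diff (Phi s x) (fun s => Phi s x)) => // j.
exact: flow_derive hPhi _ _ _.
Qed.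

Lemma dintegrand_continuous x s j : continuous (fun s => dintegrand s x j) s.
Proof.
apply: (continuous_mult (fun s => exp (2 * C * s))); first exact: continuous_exp_lin.
apply: (continuous_rsum _ _ (fun s i => dcutoff (Phi s x) i * J s x i j)) => i.
apply: (continuous_mult (fun s => dcutoff (Phi s x) i)); last exact: jacobian_continuous hJ _ _ _ _.
apply: (continuous_comp_vec n (fun y => dcutoff y i) (fun s => Phi s x)) => [k|eps he].
  exact: flow_continuous hPhi _ _ _.
have [d [hd h]] := dcutoff_vcont (Phi s x) eps he.
by exists d; split=> // y hy; apply: h.
Qed.

(** For [|s| <= M] the orbit of [x] stays in a box, since [F] is bounded. On that box the gradient
    of the cutoff is bounded and uniformly continuous, and the Jacobian is controlled uniformly on
    [[-M, M]]. *)
Lemma dintegrand_ucont x M eps : 0 <= M -> eps > 0 -> exists delta, delta > 0 /\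
  forall y, norm1 (vsub y x) < delta -> forall s, - M <= s <= M -> forall j,
    Rabs (dintegrand s y j - dintegrand s x j) < eps.
Proof.
move=> hM he.
have [E1 [hE1 h1]] := jacobian_bounded hF hJ M hM.
have [E2 [hE2 h2]] := flow_lipschitz hF hPhi M hM.
pose r := norm1 (vsub x p) + B * M.
have hB := rf_ge0 _ _ _ hF; have hn := pos_INR n.
have hr : 0 <= r by rewrite /r; have := norm1_ge0 n (vsub x p); nra.
have hbox s : Rabs s <= M -> box p r (Phi s x).
  move=> hs i; have -> : Phi s x i - p i = (Phi s x i - x i) + vsub x p i by rewrite /vsub; ring.
  apply: Rle_trans (Rabs_triang _ _) _; rewrite /r Rplus_comm.
  apply: Rplus_le_compat; first exact: abs_le_norm1.
  apply: Rle_trans (flow_displacement hF hPhi _ _ _) _.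
  by apply: Rmult_le_compat_l.
(* The dummy index in ['I_1] presents the gradient as a one-column matrix, the shape expected by
   [heine] and [bounded_on_box]. *)
have hvc z e : e > 0 -> exists delta, delta > 0 /\ forall y : vec n, norm1 (vsub y z) < delta ->
    forall i (j : 'I_1), Rabs (dcutoff y i - dcutoff z i) < e.
  by move=> /(dcutoff_vcont z) [d [hd h]]; exists d; split=> // y hy i _; apply: h.
have [K [hK hKb]] := bounded_on_box n n 1 (fun y i _ => dcutoff y i) p r hr hvc.
(* [X] bounds the weight on the window; [e1] and [e2] each allot [e / 2] to one factor of the
   product, the cutoff gradient and the Jacobian. *)
pose X := exp (2 * C * M); have hX : 0 < X := exp_pos _.
pose e := eps / (2 * X); have he0 : 0 < e by apply: Rdiv_lt_0_compat; lra.
pose e1 := e / (2 * E1); have he1 : e1 > 0 by apply: Rdiv_lt_0_compat; lra.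
have hnK : 0 <= INR n * K by apply: Rmult_le_pos.
pose e2 := e / (2 * (INR n * K + 1)).
have he2 : e2 > 0 by apply: Rdiv_lt_0_compat; lra.
have [d1 [hd1 hc]] := heine n n 1 (fun y i _ => dcutoff y i) p r e1 hr he1 hvc.
have [d2 [hd2 hj]] := jacobian_ucont hF hPhi hJ M e2 hM he2.
exists (Rmin (d1 / E2) d2); split.
  by apply: Rmin_pos => //; apply: Rdiv_lt_0_compat.
move=> y hy s hs j; have hsM : Rabs s <= M by apply: Rabs_le.
have hy1 := Rlt_le_trans _ _ _ hy (Rmin_l _ _).
have hy2 := Rlt_le_trans _ _ _ hy (Rmin_r _ _).
have hPd : norm1 (vsub (Phi s y) (Phi s x)) < d1.
  apply: Rle_lt_trans (h2 _ _ _ hsM) _.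
  have -> : d1 = E2 * (d1 / E2) by field; lra.
  exact: Rmult_lt_compat_l.
rewrite /dintegrand -Rmult_minus_distr_l -rsum_minus Rabs_mult.
rewrite (rsum_ext _ _ (fun i => (dcutoff (Phi s y) i - dcutoff (Phi s x) i) * J s y i j +
   dcutoff (Phi s x) i * (J s y i j - J s x i j))); last by move=> i; ring.
have hA : Rabs (\rsum_(i < n) ((dcutoff (Phi s y) i - dcutoff (Phi s x) i) * J s y i j)) <= e1 * E1.
  apply: (Rle_trans _ (e1 * norm1 (fun i => J s y i j))).
    apply: (rsum_mul_le _ (fun i => dcutoff (Phi s y) i - dcutoff (Phi s x) i)) => i.
    by left; apply: (hc _ _ (hbox s hsM) hPd i ord0).
  by apply: Rmult_le_compat_l; [lra|apply: h1].
have hA' : Rabs (\rsum_(i < n) (dcutoff (Phi s x) i * (J s y i j - J s x i j))) <= e2 * (INR n * K).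
  apply: (Rle_trans _ (e2 * norm1 (dcutoff (Phi s x)))).
    apply: (rsum_mul_le' _ (dcutoff (Phi s x)) (fun i => J s y i j - J s x i j)) => i.
    by left; apply: hj.
  apply: Rmult_le_compat_l; first lra.
  by apply: norm1_le_const => i; apply: (hKb _ (hbox s hsM) i ord0).
rewrite rsum_plus.
have hA1 : e1 * E1 = e / 2 by rewrite /e1; field; lra.
have hA2 : e2 * (INR n * K) <= e / 2.
  have -> : e / 2 = e2 * (INR n * K + 1) by rewrite /e2; field; lra.
  by apply: Rmult_le_compat_l; lra.
have hexp : 0 <= Rabs (exp (2 * C * s)) <= X.
  split; first exact: Rabs_pos.
  rewrite Rabs_pos_eq; last by left; apply: exp_pos.
  have : 2 * C * s <= 2 * C * M by apply: Rmult_le_compat_l; [have := expansion_rate_gt0 _ _ _ _ hF; lra|lra].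
  by case=> [h|->]; [left; apply: exp_increasing|right].
apply: (Rle_lt_trans _ (X * e)).
  apply: Rmult_le_compat; [lra|exact: Rabs_pos|lra|].
  by apply: Rle_trans (Rabs_triang _ _) _; lra.
have -> : X * e = eps / 2 by rewrite /e; field; lra.
lra.
Qed.

(** * The integral over all times and its derivative *)

Definition off x M := forall s, M <= Rabs s -> dist2 (Phi s x) <= r1 \/ r2 <= dist2 (Phi s x).

Lemma off_integrand x M s : off x M -> M <= Rabs s -> integrand s x = 0.
Proof.
move=> h hs; rewrite /integrand /cutoff.
by rewrite (proj1 (bump_out r1 r2 _ (Rlt_le _ _ hr12) (h s hs))) Rmult_0_r.
Qed.

Lemma off_dintegrand x M s j : off x M -> M <= Rabs s -> dintegrand s x j = 0.
Proof.
move=> h hs; rewrite /dintegrand big1 ?Rmult_0_r // => i _.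
by rewrite /dcutoff (proj2 (bump_out r1 r2 _ (Rlt_le _ _ hr12) (h s hs))) !Rmult_0_l.
Qed.

(** A limit along symmetric intervals gives one function independent of any window. It is evaluated
    only for integrands vanishing outside some [[-M, M]], where the sequence is eventually constant;
    elsewhere its value carries no meaning. *)
Definition improper (h : R -> R) : R :=
  real (Lim_seq (fun k => RInt h (- INR k) (INR k))).

Lemma improperE (h : R -> R) M : 0 <= M -> (forall s, continuous h s) ->
  (forall s, M <= Rabs s -> h s = 0) -> improper h = RInt h (- M) M.
Proof.
move=> hM hc h0; rewrite /improper (Lim_seq_ext_loc _ (fun _ => RInt h (- M) M)).
  by rewrite Lim_seq_const.
have [k hk] := INR_unbounded M.
exists k => m hm; have hkm : INR k <= INR m by apply: le_INR.
by apply: RInt_support => //; lra.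
Qed.

Definition lyap x := improper (fun s => integrand s x).
Definition dlyap x : vec n := fun j => improper (fun s => dintegrand s x j).

Lemma lyapE x M : 0 <= M -> off x M -> lyap x = RInt (fun s => integrand s x) (- M) M.
Proof.
move=> hM hx; apply: improperE => // [s|s hs]; first exact: integrand_continuous.
exact: off_integrand hs.
Qed.

Lemma dlyapE x M j : 0 <= M -> off x M -> dlyap x j = RInt (fun s => dintegrand s x j) (- M) M.
Proof.
move=> hM hx; apply: improperE => // [s|s hs]; first exact: dintegrand_continuous.
exact: off_dintegrand hs.
Qed.

Lemma lyap_p : lyap p = 0.
Proof.
have hoff : off p 0 by move=> s _; left; rewrite (flow_equilibrium hF hPhi _ _ hp) dist2_p; lra.
by rewrite (lyapE p 0) ?Ropp_0 ?RInt_point //; apply: Rle_refl.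
Qed.

(** After a long forward time attraction has brought the orbit below [r1]. If at a very negative
    time [s] the orbit were inside the [r2] ball, flowing forward by [- s] would bring [x] itself
    below [eps]; so it must then be beyond [r2]. *)
Lemma off_uniform eps : eps > 0 -> exists M, 0 <= M /\
  forall x, eps <= dist2 x -> dist2 x < r2 -> off x M.
Proof.
move=> he.
have [T [hT h]] := uniformly_attractive r2 eps hr2 hr2' he.
have [T1 [hT1 h1]] := uniformly_attractive r2 r1 hr2 hr2' hr1.
exists (Rmax T T1); split; first exact: Rle_trans hT (Rmax_l _ _).
move=> x hx hx2 s hs.
have hs1 := Rle_trans _ _ _ (Rmax_l _ _) hs; have hs2 := Rle_trans _ _ _ (Rmax_r _ _) hs.
case: (Rle_dec 0 s) => h0.
  by rewrite Rabs_pos_eq // in hs2; left; left; apply: h1 => //; lra.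
rewrite Rabs_left in hs1; last lra.
right; apply: Rnot_lt_le => hlt.
have := h (Phi s x) (Rlt_le _ _ hlt) (- s) hs1.
rewrite (flow_group hF hPhi) Rplus_opp_l (flow0 _ _ hPhi); lra.
Qed.

(** A single window [M] serves a whole neighbourhood of [x], so [lyap] is locally an integral over a
    fixed compact interval. *)
Lemma lyap_regular x : x <> p -> dist2 x < r2 -> exists M d, 0 <= M /\ d > 0 /\
  forall y, norm1 (vsub y x) < d -> off y M /\ curve_diff_at lyap y (dlyap y).
Proof.
move=> hxp hx; have h0 : 0 < dist2 x := normsq_gt0 _ _ _ hxp.
(* This tolerance keeps the neighbours in the shell [dist2 x / 2 <= dist2 y < r2], to which the
   window applies. *)
pose e := Rmin (dist2 x / 2) (r2 - dist2 x).
have he : e > 0 by apply: Rmin_pos; lra.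
have [|M [hM h]] := off_uniform (dist2 x / 2); first lra.
have [d [hd hd']] := normsq_vcont n p x e he.
have hoff y : norm1 (vsub y x) < d -> off y M.
  move=> hy; have /Rabs_def2 := hd' y hy; rewrite -!/(dist2 _) => h1.
  have := Rmin_l (dist2 x / 2) (r2 - dist2 x); have := Rmin_r (dist2 x / 2) (r2 - dist2 x).
  by rewrite -/e => h2 h3; apply: h; lra.
exists M, d; split=> //; split=> // y hy; split; first exact: hoff.
have hd2 : d - norm1 (vsub y x) > 0 by lra.
apply: (curve_diff_local n (fun z => RInt (fun s => integrand s z) (- M) M) _ _ _ _ hd2).
  move=> z hz; symmetry; apply: lyapE => //; apply: hoff.
  by have := norm1_triangle n z y x; lra.
have -> : dlyap y = fun j => RInt (fun s => dintegrand s y j) (- M) M.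
  by apply: functional_extensionality => j; apply: dlyapE => //; apply: hoff.
apply: RInt_curve_diff => [||s z|s z j|eps heps]; first lra.
- exact: integrand_curve_diff.
- exact: integrand_continuous.
- exact: dintegrand_continuous.
- exact: dintegrand_ucont.
Qed.

Lemma dlyap_continuous x eps : x <> p -> dist2 x < r2 -> eps > 0 -> exists delta, delta > 0 /\
  forall y, norm1 (vsub y x) < delta -> forall j, Rabs (dlyap y j - dlyap x j) < eps.
Proof.
move=> hxp hx he; have [M [d [hM [hd h]]]] := lyap_regular x hxp hx.
have he' : eps / (2 * M + 1) > 0 by apply: Rdiv_lt_0_compat; lra.
have [d1 [hd1 h1]] := dintegrand_ucont x M _ hM he'.
exists (Rmin d d1); split=> [|y hy j]; first exact: Rmin_pos.
have [hy1 _] := h y (Rlt_le_trans _ _ _ hy (Rmin_l _ _)).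
have hxx : norm1 (vsub x x) < d by rewrite norm1_vsub0; lra.
have [hx1 _] := h x hxx.
rewrite (dlyapE y M) // (dlyapE x M) //.
apply: (Rle_lt_trans _ ((M - - M) * (eps / (2 * M + 1)))).
  apply: RInt_sub_le => [|s|s|s hs]; first lra.
  - exact: dintegrand_continuous.
  - exact: dintegrand_continuous.
  by left; apply: h1 => //; apply: Rlt_le_trans hy (Rmin_r _ _).
have -> : (M - - M) * (eps / (2 * M + 1)) = eps - eps / (2 * M + 1) by field; lra.
lra.
Qed.

(** It suffices that the orbit meets the open annulus. If [x] lies inside it, the backward orbit
    passes the middle level [m], and the intermediate value theorem gives a time at which [dist2]
    equals [m]. *)
Lemma lyap_gt0 x : x <> p -> dist2 x < r2 -> 0 < lyap x.
Proof.
move=> hxp hx; have h0 : 0 < dist2 x := normsq_gt0 _ _ _ hxp.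
have [M [hM h]] := off_uniform (dist2 x) h0; have {}h := h x (Rle_refl _) hx.
rewrite (lyapE x M) //.
have [s hs] : exists s, r1 < dist2 (Phi s x) < r2.
  case: (Rlt_dec r1 (dist2 x)) => hr; first by exists 0; rewrite (flow0 _ _ hPhi).
  pose m := (r1 + r2) / 2.
  have [s [hs hsm]] : exists s, s <= 0 /\ m < dist2 (Phi s x).
    (* Otherwise [Phi (- T) x] lies in the [r2] ball, and uniform attraction with tolerance
       [dist2 x] gives [dist2 x < dist2 x] after time [T]. *)
    apply: NNPP => hn; have [T [hT hT']] := uniformly_attractive r2 (dist2 x) hr2 hr2' h0.
    have hle : dist2 (Phi (- T) x) <= r2.
      apply: Rnot_lt_le => hlt; apply: hn; exists (- T); split; rewrite /m; lra.
    have := hT' _ hle T (Rle_refl _).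
    rewrite (flow_group hF hPhi) Rplus_opp_r (flow0 _ _ hPhi); lra.
  have [||t [_ ht]] := IVT_gen (fun s => dist2 (Phi s x)) s 0 m.
  - by move=> u; apply/continuity_pt_filterlim; apply: continuous_dist2_flow.
  - have hm : dist2 x < m by rewrite /m; lra.
    by rewrite (flow0 _ _ hPhi) Rmin_right ?Rmax_left; lra.
  by exists t; rewrite ht /m; lra.
apply: (RInt_pos _ _ _ s) => [r|r||].
- exact: integrand_continuous.
- by apply: Rmult_le_pos; [left; apply: exp_pos|apply: bump_ge0].
- have : Rabs s < M by apply: Rnot_le_lt => hMs; have := h s hMs; lra.
  by move/Rabs_def2; lra.
- by apply: Rmult_lt_0_compat; [apply: exp_pos|apply: bump_gt0].
Qed.

(** The substitution [s -> s + t] moves the weight by the factor [exp (- (2 * C) * t)]. The window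
    is enlarged to [N = M + |t|] so that the shifted interval still contains [[-M, M]]. *)
Lemma lyap_flow x t M : 0 <= M -> off x M -> lyap (Phi t x) = exp (- (2 * C) * t) * lyap x.
Proof.
move=> hM hx; pose N := M + Rabs t; have ht := Rabs_pos t.
have hoff : off (Phi t x) N.
  move=> s hs; rewrite (flow_group hF hPhi); apply: hx.
  have := Rabs_triang (s + t) (- t); have -> : s + t + - t = s by ring.
  by rewrite Rabs_Ropp /N in hs *; lra.
rewrite (lyapE x M) // (lyapE _ N) //; last by rewrite /N; lra.
have hcont s : continuous (fun s => integrand s x) s by apply: integrand_continuous.
rewrite (RInt_ext _ (fun s => exp (- (2 * C) * t) * (1 * integrand (1 * s + t) x))); last first.
  move=> s _; rewrite !Rmult_1_l /integrand (flow_group hF hPhi) -Rmult_assoc -exp_plus.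
  by congr (exp _ * _); ring.
rewrite (RInt_scal (V := R_CompleteNormedModule) (fun s => 1 * integrand (1 * s + t) x)); last first.
  apply: ex_RInt_cont => s.
  apply: (continuous_mult (fun _ => 1) (fun s => integrand (1 * s + t) x)); first exact: continuous_const.
  apply: (continuous_comp (fun s => 1 * s + t) (fun s => integrand s x)); last exact: hcont.
  by apply: ex_derive_continuous; auto_derive.
have -> : RInt (fun s => 1 * integrand (1 * s + t) x) (- N) N = RInt (fun s => integrand s x) (1 * - N + t) (1 * N + t).
  by apply: (RInt_comp_lin (V := R_CompleteNormedModule) (fun s => integrand s x)); apply: ex_RInt_cont.
congr (_ * _); apply: RInt_support => // [s hs||].
- exact: off_integrand hs.
- by have := Rle_abs t; rewrite /N; lra.
- by have := Rle_abs (- t); rewrite Rabs_Ropp /N; lra.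
Qed.

(** Stability keeps the forward orbit below [r1], so only [s < 0] contributes. Being beyond [r1] at
    such a time forces [r1 * exp (C * s) <= dist2 x]; this bounds one factor of the weight, and the
    other integrates to at most [1 / C], whence the constant [/ (r1 * C)]. *)
Lemma lyap_quadratic : exists d K, d > 0 /\ 0 <= K /\ forall x, dist2 x < d -> dist2 x < r2 ->
  0 <= lyap x <= K * dist2 x.
Proof.
have [d [hd h]] := stable r1 hr1; have hC := expansion_rate_gt0 _ _ _ _ hF.
have hK : 0 < / (r1 * C) by apply: Rinv_0_lt_compat; apply: Rmult_lt_0_compat.
exists d, (/ (r1 * C)); split=> //; split=> [|x hxd hx]; first lra.
case: (classic (x = p)) => [->|hxp]; first by rewrite lyap_p dist2_p; lra.
split; first by left; apply: lyap_gt0.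
have h0 : 0 < dist2 x := normsq_gt0 _ _ _ hxp.
have [M [hM hoff]] := off_uniform (dist2 x) h0; have {}hoff := hoff x (Rle_refl _) hx.
rewrite (lyapE x M) //.
rewrite -(RInt_Chasles (fun s => integrand s x) (- M) 0 M); try by apply: ex_RInt_cont => s; apply: integrand_continuous.
rewrite (RInt_ext (fun s => integrand s x) (fun _ => 0) 0 M); last first.
  rewrite Rmin_left ?Rmax_right // => s hs; rewrite /integrand /cutoff.
  rewrite (proj1 (bump_out r1 r2 _ (Rlt_le _ _ hr12) _)) ?Rmult_0_r //.
  by left; left; apply: h => //; lra.
rewrite RInt_const /scal /plus /= /mult /= Rmult_0_r Rplus_0_r.
have hI : is_RInt (fun s => dist2 x / r1 * exp (C * s)) (- M) 0
    (minus (dist2 x / (r1 * C) * exp (C * 0)) (dist2 x / (r1 * C) * exp (C * - M))).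
  apply: (is_RInt_derive (V := R_CompleteNormedModule)
    (fun s => dist2 x / (r1 * C) * exp (C * s)) (fun s => dist2 x / r1 * exp (C * s))) => s _.
    by auto_derive => //; field; lra.
  by apply: ex_derive_continuous; auto_derive.
apply: (Rle_trans _ (RInt (fun s => dist2 x / r1 * exp (C * s)) (- M) 0)).
  apply: RInt_le => [|||s hs]; first lra.
  - by apply: ex_RInt_cont => s; apply: integrand_continuous.
  - by eexists; apply: hI.
  have hE := exp_pos (C * s).
  have hq : 0 <= dist2 x / r1 by apply: Rdiv_le_0_compat; lra.
  case: (Rle_dec (dist2 (Phi s x)) r1) => hs1.
    rewrite /integrand /cutoff (proj1 (bump_out r1 r2 _ (Rlt_le _ _ hr12) (or_introl hs1))) Rmult_0_r.
    by apply: Rmult_le_pos; lra.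
  have h1 := flow_expansion hF hPhi p s x hp.
  rewrite -!/(dist2 _) -/(expansion_rate n B) Rabs_left in h1; last lra.
  have h2 : exp (C * - s) * exp (C * s) = 1 by rewrite -exp_plus -exp_0; congr exp; ring.
  have h3 : r1 * exp (C * s) <= dist2 x.
    apply: (Rle_trans _ (dist2 x * exp (C * - s) * exp (C * s))).
      by apply: Rmult_le_compat_r; lra.
    by rewrite Rmult_assoc h2; lra.
  have h4 : exp (C * s) <= dist2 x / r1.
    apply: (Rmult_le_reg_l r1) => //; have -> : r1 * (dist2 x / r1) = dist2 x by field; lra.
    exact: h3.
  have h5 : exp (2 * C * s) = exp (C * s) * exp (C * s) by rewrite -exp_plus; congr exp; ring.
  have h6 := bump_le1 r1 r2 (dist2 (Phi s x)) (Rlt_le _ _ hr1) (Rlt_le _ _ hr12) hr2.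
  rewrite /integrand h5 /cutoff.
  have h7 := bump_ge0 r1 r2 (dist2 (Phi s x)).
  apply: (Rle_trans _ (exp (C * s) * exp (C * s) * 1)).
    by apply: Rmult_le_compat_l; nra.
  by rewrite Rmult_1_r; apply: Rmult_le_compat_r; lra.
rewrite (is_RInt_unique _ _ _ _ hI) /minus /plus /opp /= Rmult_0_r exp_0.
have -> : / (r1 * C) * dist2 x = dist2 x / (r1 * C) by rewrite Rmult_comm.
have : 0 <= dist2 x / (r1 * C) * exp (C * - M).
  apply: Rmult_le_pos; last by left; apply: exp_pos.
  by apply: Rmult_le_pos; lra.
lra.
Qed.

End Lyapunov.

(** * From the given equation to the truncated flow *)

Lemma vnorm_lt_sqr n (x : vec n) e : vnorm x < e -> normsq x < e * e.
Proof. by move=> h; rewrite -vnorm_normsq; have := vnorm_ge0 n x; nra. Qed.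

Lemma vnorm_lt_of_normsq n (x : vec n) e : 0 < e -> normsq x < e * e -> vnorm x < e.
Proof. by move=> he; rewrite -vnorm_normsq; have := vnorm_ge0 n x; nra. Qed.

Section Transfer.
Context {n : nat} {f F : vec n -> vec n} {DF : vec n -> mat n n} {B : R}
  {Phi : R -> vec n -> vec n} {p : vec n}.
Hypothesis (hF : regular_field F DF B) (hPhi : is_flow F Phi).
Hypothesis (hFf : forall x, box p 1 x -> F x = f x).

(** In the unit ball the two fields agree, so [phi] also solves the truncated equation, and forward
    uniqueness applies. *)
Lemma flow_eq_solution phi : forward_solution f phi ->
  (forall t, 0 <= t -> vnorm (vsub (phi t) p) < 1) ->
  forall t, 0 <= t -> Phi t (phi 0) = phi t.
Proof.
move=> hphi h1; apply: (solution_unique_forward hF (fun t => Phi t (phi 0))) => [t _ i|t ht i|].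
- exact: (flow_derive _ _ hPhi).
- rewrite hFf; first by apply/is_derive_Reals; apply: hphi; lra.
  by move=> j; apply: Rle_trans (abs_le_vnorm n (vsub (phi t) p) j) _; left; apply: h1.
exact: flow0 hPhi _.
Qed.

Lemma flow_stable : lyap_stable f p -> forall eps, eps > 0 -> exists delta, delta > 0 /\
  forall x, normsq (vsub x p) < delta -> forall t, 0 <= t -> normsq (vsub (Phi t x) p) < eps.
Proof.
(* The cap by [1] confines the solution to the region where [F = f], so that it is an orbit of
   [Phi]. *)
move=> hs eps he; pose e := Rmin (sqrt eps) 1.
have hsq : 0 < sqrt eps by apply: sqrt_lt_R0.
have he0 : 0 < e by apply: Rmin_pos; lra.
have [d [hd h]] := hs e he0.
exists (d * d); split=> [|x hx t ht]; first by apply: Rmult_lt_0_compat.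
have [[phi [hphi h0]] hall] := h x (vnorm_lt_of_normsq _ _ _ hd hx).
have hle := Rmin_l (sqrt eps) 1; have hle1 := Rmin_r (sqrt eps) 1; rewrite -/e in hle hle1.
have hb s : 0 <= s -> vnorm (vsub (phi s) p) < e by move=> hs0; apply: hall => //; lra.
rewrite -h0 flow_eq_solution //; last by move=> s hs0; have := hb s hs0; lra.
apply: Rlt_le_trans (vnorm_lt_sqr _ _ _ (hb t ht)) _.
by rewrite -(sqrt_sqrt eps); [nra|lra].
Qed.

Lemma flow_attractive : asymptotically_stable f p -> exists eta, eta > 0 /\
  forall x, normsq (vsub x p) < eta -> forall eps, eps > 0 ->
    exists T, 0 <= T /\ normsq (vsub (Phi T x) p) < eps.
Proof.
move=> [_ [hs [eta [heta ha]]]]; have [d [hd h]] := hs 1 Rlt_0_1.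
(* Here [d] is the stability radius for the unit ball: it makes the solution an orbit of [Phi],
   while [eta] makes it converge. *)
pose e := Rmin eta d; have he : 0 < e by apply: Rmin_pos.
exists (e * e); split=> [|x hx eps heps]; first by apply: Rmult_lt_0_compat.
have hxe := vnorm_lt_of_normsq _ _ _ he hx.
have [[phi [hphi h0]] hall] := h x (Rlt_le_trans _ _ _ hxe (Rmin_r _ _)).
have [_ hconv] := ha x (Rlt_le_trans _ _ _ hxe (Rmin_l _ _)).
have [T hT] := hconv phi hphi h0 (sqrt eps) (sqrt_lt_R0 _ heps).
exists (Rmax 0 T); split; first exact: Rmax_l.
rewrite -h0 flow_eq_solution //; last exact: Rmax_l.
  rewrite -(sqrt_sqrt eps); last lra.
  by apply: vnorm_lt_sqr; apply: hT; apply: Rle_ge; apply: Rmax_r.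
by move=> s hs0; apply: hall => //; lra.
Qed.

End Transfer.

Theorem mainTheorem11 (n : nat) (f : vec n -> vec n) (p : vec n)
  (hf : C1_on (fun _ => True) f)
  (hp : asymptotically_stable f p) :
  exists (U : vec n -> Prop) (a : R) (L : vec n -> R),
    is_open U /\ U p /\ a > 0 /\
    (forall x, U x -> differentiable_at (as_vec1 L) x) /\
    C1_on (fun x => U x /\ x <> p) (as_vec1 L) /\
    L p = 0 /\
    (forall x, U x -> x <> p -> L x > 0) /\
    (forall x, U x -> orbital_derivative_is f L x (- a * L x)).
Proof.
have hpf : equilibrium f p := proj1 hp.
have [F [DF [B [hF hFf]]]] := truncated_field n f p hf hpf.
have hpF : equilibrium F p.
  by move=> i; rewrite hFf // => j; rewrite Rminus_diag Rabs_R0; lra.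
have [Phi hPhi] := flow_exists hF.
have [J hJ] := jacobian_exists hF hPhi.
have hs := flow_stable hF hPhi hFf (proj1 (proj2 hp)).
have [eta [heta ha]] := flow_attractive hF hPhi hFf hp.
(* [r2 <= 1] places [U] where [F = f] and keeps the bump below [1]; [eta / 2] leaves a strict margin
   inside the basin. *)
pose r2 := Rmin 1 (eta / 2); pose r1 := r2 / 2.
have hr2 : r2 <= 1 := Rmin_l _ _.
have hr2' : r2 < eta by have := Rmin_r 1 (eta / 2); rewrite -/r2; lra.
have hr0 : 0 < r2 by apply: Rmin_pos; lra.
have hr1 : 0 < r1 by apply: Rdiv_lt_0_compat => //; lra.
have hr12 : r1 < r2 by move: hr0; rewrite /r1; lra.
pose L := @lyap n B Phi p r1 r2.
pose dL := @dlyap n B Phi J p r1 r2.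
pose a := 2 * expansion_rate n B.
have ha0 : a > 0 by have := expansion_rate_gt0 _ _ _ _ hF; rewrite /a; lra.
have hLp : L p = 0 := lyap_p hF hPhi hpF hr1 hr12.
have hreg := lyap_regular hF hPhi hJ hs ha hr1 hr12 hr2 hr2'.
have hder x : x <> p -> dist2 (p := p) x < r2 -> has_derivative_at (as_vec1 L) x (fun _ => dL x).
  move=> hxp hx; have [M [d [_ [hd h]]]] := hreg x hxp hx.
  apply: (derivative_of_curve_diff n 1 (as_vec1 L) (fun y _ => dL y) x d hd) => [y hy i|eps he].
    exact: (proj2 (h y hy)).
  have [e [he0 h']] := dlyap_continuous hF hPhi hJ hs ha hr1 hr12 hr2 hr2' x eps hxp hx he.
  by exists e; split=> // y hy _ j; apply: h'.
have hderp : has_derivative_at (as_vec1 L) p (fun _ _ => 0).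
  have [d [K [hd [hK h]]]] := lyap_quadratic hF hPhi hpF hs ha hr1 hr12 hr2 hr2'.
  (* With [|h| < 1] one has [|h|^2 <= |h|], which puts [p + h] in the range of the quadratic bound;
     the last entry gives [K * |h|^2 <= eps * |h|]. *)
  move=> eps he; pose e := Rmin (Rmin (Rmin d r2) 1) (eps / (K + 1)).
  have heK : 0 < eps / (K + 1) by apply: Rdiv_lt_0_compat; lra.
  have he0 : 0 < e by apply: Rmin_pos => //; apply: Rmin_pos; [apply: Rmin_pos; lra|lra].
  exists e; split=> // h0 hh0; have hv := vnorm_ge0 n h0.
  have e1 : e <= Rmin (Rmin d r2) 1 := Rmin_l _ _.
  have e2 : e <= eps / (K + 1) := Rmin_r _ _.
  have e3 := Rmin_l (Rmin d r2) 1; have e4 := Rmin_r (Rmin d r2) 1.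
  have e5 := Rmin_l d r2; have e6 := Rmin_r d r2.
  have hq : dist2 (p := p) (vadd p h0) = vnorm h0 * vnorm h0.
    by rewrite vnorm_normsq; apply: rsum_ext => i; rewrite /vadd /vsub; ring.
  have hq1 : dist2 (p := p) (vadd p h0) < Rmin d r2 by rewrite hq; nra.
  have [] := h (vadd p h0); [lra|lra|].
  rewrite -/L hq => hl1 hl2.
  apply: Rle_trans (vnorm_le_norm1 _ _) _.
  apply: (Rle_trans _ (INR 1 * (eps * vnorm h0))); last by rewrite /=; lra.
  apply: norm1_le_const => i; rewrite /vsub /as_vec1 /matvec big1; last by move=> j _; ring.
  rewrite hLp !Rminus_0_r Rabs_pos_eq //.
  apply: Rle_trans hl2 _; rewrite -Rmult_assoc; apply: Rmult_le_compat_r => //.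
  have : (K + 1) * (eps / (K + 1)) = eps by field; lra.
  nra.
exists (fun x => dist2 (p := p) x < r2), a, L.
split.
  move=> x hx; have [|d [hd h]] := normsq_vcont n p x (r2 - dist2 (p := p) x); first lra.
  have hn := pos_INR n.
  exists (d / (INR n + 1)); split; first by apply: Rdiv_lt_0_compat; lra.
  move=> y hy; have hyd : norm1 (vsub y x) < d.
    apply: Rle_lt_trans (norm1_le_vnorm n _) _.
    have -> : d = (INR n + 1) * (d / (INR n + 1)) by field; lra.
    by apply: Rmult_lt_compat_l; lra.
  by have /Rabs_def2 := h y hyd; rewrite /dist2; rewrite /dist2 in hx *; lra.
have hdiff x : dist2 (p := p) x < r2 -> differentiable_at (as_vec1 L) x.
  move=> hx; case: (classic (x = p)) => [->|hxp]; first by exists (fun _ _ => 0).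
  by exists (fun _ => dL x); apply: hder.
split; first by rewrite dist2_p.
split=> //; split=> //; split.
  exists (fun x _ => dL x); split=> [x [hx hxp]|x [hx hxp] eps he]; first exact: hder.
  have [e [he0 h']] := dlyap_continuous hF hPhi hJ hs ha hr1 hr12 hr2 hr2' x eps hxp hx he.
  have hn := pos_INR n.
  exists (e / (INR n + 1)); split; first by apply: Rdiv_lt_0_compat; lra.
  move=> y _ hy _ j; apply: h'; apply: Rle_lt_trans (norm1_le_vnorm n _) _.
  have -> : e = (INR n + 1) * (e / (INR n + 1)) by field; lra.
  by apply: Rmult_lt_compat_l; lra.
split=> //; split.
  by move=> x hx hxp; apply: (lyap_gt0 hF hPhi hs ha hr1 hr12 hr2 hr2').
move=> x hx phi [e [he hphi]] h0.
(* As [L] is differentiable at [x], its derivative along any curve through [x] depends only on the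
   velocity. The given solution and the orbit of [Phi] share the velocity [f x = F x], so the
   derivative can be computed along [Phi], where [L] is an explicit exponential. *)
have [A hA] := hdiff x hx.
have hLc := curve_diff_of_derivative n 1 _ x A ord0 hA.
have hFx : F x = f x.
  apply: hFf => i; have := sqr_le_normsq n (vsub x p) i; rewrite -/(dist2 x) /vsub.
  by move: hx; rewrite /dist2 => hx h1; apply: Rabs_le; nra.
have hphi0 i : is_derive (fun s => phi s i) 0 (F x i).
  by apply/is_derive_Reals; rewrite hFx -h0; apply: hphi; rewrite Rabs_R0.
have d1 := hLc phi (F x) 0 h0 hphi0.
have hPhi0 i : is_derive (fun s => Phi s x i) 0 (F x i).
  by have := flow_derive _ _ hPhi x 0 i; rewrite (flow0 _ _ hPhi).
have d2 := hLc (fun s => Phi s x) (F x) 0 (flow0 _ _ hPhi x) hPhi0.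
have hflow t : L (Phi t x) = exp (- a * t) * L x.
  case: (classic (x = p)) => [->|hxp].
    by rewrite (flow_equilibrium hF hPhi _ _ hpF) hLp Rmult_0_r.
  have [M [d [hM [hd h]]]] := hreg x hxp hx.
  apply: (lyap_flow hF hPhi hr12 x t M hM).
  by apply: (proj1 (h x _)); rewrite norm1_vsub0.
have d3 : is_derive (fun t => L (Phi t x)) 0 (- a * L x).
  apply: (is_derive_ext (fun t => exp (- a * t) * L x)) => [t|]; first by rewrite hflow.
  by auto_derive => //; rewrite Rmult_0_r exp_0; ring.
apply/is_derive_Reals.
have -> : - a * L x = \rsum_(j < n) (A ord0 j * F x j).
  by rewrite -(is_derive_unique _ _ _ d2) -(is_derive_unique _ _ _ d3).
exact: d1.
Qed.
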